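(* Let $(X,\mu,H,\Pi,\mathcal{M}_0,A)$ be as in the Abstract Setting and suppose there is $x_0\in X$ such that (i') $x_0$ is a peak point for $A$: there is $f_0\in A$ with $f_0(x_0)=1$ and $|f_0(x)|<1$ for all $x\in X\setminus\{x_0\}$; and (ii') $\sigma(\{x_0\})=0$ for every $\sigma\in\mathcal{M}_0$. Then $\Pi$ cannot be extended to a bounded linear operator on $L^1(X,\mu)$.
   Context: Abstract Setting: $X$ is a compact connected Hausdorff space; $\mu$ is a finite regular Borel measure of full support. $\mathcal{M}(X)$ is the space of regular complex Borel measures on $X$ (dual of $C(X)$) with weak-$*$ topology, $L^1(X,\mu)\subset\mathcal{M}(X)$ via $f\mapsto f\,d\mu$. $H$ is a closed subspace of $L^2(X,\mu)$, $\Pi$ the orthogonal projection onto $H$, $\mathcal{M}_0$ the weak-$*$ closure of $H$ in $\mathcal{M}(X)$, and $A\subseteq C(X)\cap H$ a linear subspace containing constants and closed under multiplication. ''$\Pi$ extends boundedly to $L^1$'' means $\|\Pi f\|_{L^1}\le C\|f\|_{L^1}$ for all $f\in L^2(X,\mu)$ and some $C<\infty$. *)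

(* Defs.v *)
From HB Require Import structures.
From mathcomp Require Import all_boot all_order all_algebra.
From mathcomp Require Import all_classical all_reals all_analysis.
From mathcomp.real_closed Require Import complex.
Import Order.TTheory GRing.Theory Num.Theory.
Import numFieldNormedType.Exports.

Set Implicit Arguments.
Unset Strict Implicit.
Unset Printing Implicit Defensive.

Local Open Scope classical_set_scope.
Local Open Scope ring_scope.

Definition BorelT (X : ptopologicalType) := g_sigma_algebraType (@open X).

Section Setting.
Variables (R : realType) (X : ptopologicalType).
Local Notation T := (BorelT X).
Local Notation C := R[i].

Definition cabs (z : C) : R :=
  Num.sqrt (complex.Re z ^+ 2 + complex.Im z ^+ 2).

Definition ccontinuous (f : X -> C) :=
  continuous (fun x : X => complex.Re (f x)) /\
  continuous (fun x : X => complex.Im (f x)).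

Definition cmeasurable (f : X -> C) :=
  measurable_fun [set: T] (fun x : T => complex.Re (f x)) /\
  measurable_fun [set: T] (fun x : T => complex.Im (f x)).

Definition cint (m : {measure set T -> \bar R}) (f : X -> C) : C :=
  Complex (Rintegral m [set: T] (fun x : T => complex.Re (f x)))
          (Rintegral m [set: T] (fun x : T => complex.Im (f x))).

Definition finite_measure (m : {measure set T -> \bar R}) :=
  (m [set: T] < +oo)%E.

Definition regular_measure (m : {measure set T -> \bar R}) :=
  forall E : set T, measurable E ->
    m E = ereal_inf [set m U | U in [set U : set T | open (U : set X) /\ E `<=` U]]
    /\ m E = ereal_sup [set m K | K in [set K : set T | compact (K : set X) /\ K `<=` E]].

Definition full_support (m : {measure set T -> \bar R}) :=
  forall U : set X, open U -> U !=set0 -> (0 < m (U : set T))%E.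

Definition finite_regular (m : {measure set T -> \bar R}) :=
  finite_measure m /\ regular_measure m.

(* Regular complex Borel measures sigma are represented (Jordan decomposition)
   as sigma = m1 - m2 + i (m3 - m4) with m1..m4 finite regular positive Borel
   measures.  Value of sigma on a Borel set, and integral of a continuous
   function against sigma (the duality pairing <sigma, phi> with C(X)). *)
Definition cmeas_val (m1 m2 m3 m4 : {measure set T -> \bar R}) (E : set T) : C :=
  Complex (fine (m1 E) - fine (m2 E)) (fine (m3 E) - fine (m4 E)).

Definition cmeas_int (m1 m2 m3 m4 : {measure set T -> \bar R}) (phi : X -> C) : C :=
  cint m1 phi - cint m2 phi + 'i%C * (cint m3 phi - cint m4 phi).

Variable mu : {measure set T -> \bar R}.

Definition L2 (f : X -> C) :=
  cmeasurable f /\ (\int[mu]_(x in [set: T]) ((cabs (f x)) ^+ 2)%:E < +oo)%E.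

Definition L1norm (f : X -> C) : \bar R :=
  (\int[mu]_(x in [set: T]) (cabs (f x))%:E)%E.

Definition ip (f g : X -> C) : C := cint mu (fun x => f x * conjc (g x)).

(* H is a closed linear subspace of L^2(X,mu) (as a set of representatives;
   closedness forces H to be saturated under a.e. equality) *)
Definition closed_L2_subspace (H : set (X -> C)) :=
  (forall h, H h -> L2 h) /\
  H (fun _ => 0) /\
  (forall (a : C) h g, H h -> H g -> H (fun x => a * h x + g x)) /\
  (forall (h : nat -> X -> C) (f : X -> C), (forall n, H (h n)) -> L2 f ->
     ((fun n => (\int[mu]_(x in [set: T]) ((cabs (h n x - f x)) ^+ 2)%:E)%E)
        @ \oo --> 0%E) ->
     H f).

Definition is_orth_proj (H : set (X -> C)) (f g : X -> C) :=
  H g /\ forall h, H h -> ip (fun x => f x - g x) h = 0.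

Definition proj_L1_bounded (H : set (X -> C)) :=
  exists K : R, forall f g : X -> C, L2 f -> is_orth_proj H f g ->
    (L1norm g <= K%:E * L1norm f)%E.

Definition function_algebra_in (H A : set (X -> C)) :=
  (forall f, A f -> ccontinuous f /\ H f) /\
  (forall c : C, A (fun _ => c)) /\
  (forall (a : C) f g, A f -> A g -> A (fun x => a * f x + g x)) /\
  (forall f g, A f -> A g -> A (fun x => f x * g x)).

Definition peak_point (A : set (X -> C)) (x0 : X) :=
  exists f0, A f0 /\ f0 x0 = 1 /\ forall x, x <> x0 -> cabs (f0 x) < 1.

(* sigma = m1 - m2 + i(m3 - m4) lies in M_0, the weak-* closure of H in M(X)
   (H embedded via h |-> h dmu): every basic weak-* neighbourhood of sigma,
   given by finitely many phi_i in C(X) and eps > 0, meets H. *)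
Definition in_weakstar_closure (H : set (X -> C))
    (m1 m2 m3 m4 : {measure set T -> \bar R}) :=
  forall (n : nat) (phi : 'I_n -> X -> C), (forall i, ccontinuous (phi i)) ->
  forall eps : R, 0 < eps ->
  exists h, H h /\ forall i,
    cabs (cint mu (fun x => phi i x * h x) - cmeas_int m1 m2 m3 m4 (phi i)) < eps.

End Setting.

(* Main.v *)
Require Import Defs.
From HB Require Import structures.
From mathcomp Require Import all_boot all_order all_algebra.
From mathcomp Require Import all_classical all_reals all_analysis.
From mathcomp.real_closed Require Import complex.
From mathcomp Require Import measurable_realfun ring lra.
Import Order.TTheory GRing.Theory Num.Theory.
Import numFieldNormedType.Exports.
Local Open Scope classical_set_scope.
Local Open Scope ring_scope.

(** Suppose the projection is bounded by [K] in [L^1].  Choose nonnegative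
    densities [f n] of integral 1 supported in open neighbourhoods of [x0] on which
    the powers of the peaking function [f0] are close to 1.  The projections
    [h n] of [f n] are bounded by [K] in [L^1], so along an ultrafilter the
    measures [h n dmu] converge weak-* to a measure [sigma] (Riesz-Markov), which
    lies in the weak-* closure of [H].  Since the powers of [f0] lie in [H],
    [int conj(f0^k) dsigma = lim <h n, f0^k> = lim <f n, f0^k> = 1] for every
    [k >= 1], while dominated convergence as [k] tends to infinity turns the left
    side into [sigma {x0} = 0]. *)

Set Implicit Arguments.
Unset Strict Implicit.
Unset Printing Implicit Defensive.

(** * Riesz-Markov representation on a compact Hausdorff space *)

Section borel.
Context {R : realType} {X : ptopologicalType}.

(** The hypothesis on [x0] speaks only of measures in the weak-* closure of [H], so boundedness in
    [L^1] has to produce an actual measure. [X] need not be metrizable: [C(X)] may be nonseparable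
    and bounded sequences of measures may have no convergent subsequence, hence the limit along an
    ultrafilter. For the same reason no sequence of neighbourhoods need shrink to [x0]; all that is
    asked of the densities is the correct limit against the countably many powers of [f0]. These
    powers play two roles: as elements of [H] they cannot distinguish [f n] from its projection, and
    as powers of a peaking function they tend to the indicator of [x0]. Finally, [proj_L1_bounded]
    quantifies over pairs related by [is_orth_proj], so it gives bounds only once projections are
    known to exist; this is where the completeness of [L^2] and the closedness of [H] enter. *)

Lemma open_borel_measurable (U : set X) : open U -> measurable (U : set (BorelT X)).
Proof. by move=> oU; exact: sub_sigma_algebra. Qed.

Lemma continuous_borel_measurable (f : X -> R) : continuous f ->
  measurable_fun [set: BorelT X] (f : BorelT X -> R).
Proof.
move=> /continuousP cf; apply: (measurability _ (RGenOpens.measurableE R)).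
move=> _ [_ [a [b ->] <-]]; rewrite setTI; apply: open_borel_measurable.
exact/cf/interval_open.
Qed.

Lemma compact_continuous_bounded (f : X -> R) : compact [set: X] ->
  continuous f -> exists2 M, 0 < M & forall x, `|f x| <= M.
Proof.
move=> KX cf.
have cfX : compact (f @` setT).
  by apply: continuous_compact => //; exact: continuous_subspaceT.
have /pinfty_ex_gt0[M M0 hM] := compact_bounded cfX.
by exists M => // x; apply: hM; exists x.
Qed.

End borel.

Section integrals.
Context {d} {T : measurableType d} {R : realType}.
Variable m : {measure set T -> \bar R}.

Lemma bounded_integrable (f : T -> R) (M : R) : (m setT < +oo)%E ->
  measurable_fun setT f -> (forall x, `|f x| <= M) ->
  m.-integrable setT (EFin \o f).
Proof.
move=> fm mf fM; apply: measurable_bounded_integrable => //.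
by exists M; split => [|x Mx y _]; [exact: num_real|apply: le_trans (fM y) _; exact: ltW].
Qed.

End integrals.

Section riesz_markov.
Context {R : realType} {X : ptopologicalType}.
Hypotheses (HX : hausdorff_space X) (KX : compact [set: X]).
Variable L : (X -> R) -> R.
Hypothesis Llin : forall (a : R) (f g : X -> R), continuous f -> continuous g ->
  L (fun x => a * f x + g x) = a * L f + L g.
Hypothesis Lpos : forall f : X -> R, continuous f -> (forall x, 0 <= f x) -> 0 <= L f.

Let ccst (c : R) : continuous (fun _ : X => c).
Proof. by move=> x; exact: cvg_cst. Qed.

Let cD (f g : X -> R) : continuous f -> continuous g ->
  continuous (fun x => f x + g x).
Proof. by move=> cf cg x; apply: cvgD; [exact: cf|exact: cg]. Qed.

Let cB (f g : X -> R) : continuous f -> continuous g ->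
  continuous (fun x => f x - g x).
Proof. by move=> cf cg x; apply: cvgB; [exact: cf|exact: cg]. Qed.

Let cM (f g : X -> R) : continuous f -> continuous g ->
  continuous (fun x => f x * g x).
Proof. by move=> cf cg x; apply: cvgM; [exact: cf|exact: cg]. Qed.

Let L0 : L (fun _ => 0) = 0.
Proof.
have := Llin 1 (@ccst 0) (@ccst 0).
rewrite (_ : (fun x => _) = (fun=> 0)); last by apply/funext => x; rewrite mulr0 addr0.
by rewrite mul1r => /eqP; rewrite -subr_eq0 opprD addrA subrr sub0r oppr_eq0 => /eqP.
Qed.

Let LD (f g : X -> R) : continuous f -> continuous g ->
  L (fun x => f x + g x) = L f + L g.
Proof.
move=> cf cg; rewrite -[L f]mul1r -Llin//; congr L.
by apply/funext => x; rewrite mul1r.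
Qed.

Let LZ a (f : X -> R) : continuous f -> L (fun x => a * f x) = a * L f.
Proof.
move=> cf; rewrite -[RHS]addr0 -L0 -Llin//; congr L.
by apply/funext => x; rewrite addr0.
Qed.

Let LB (f g : X -> R) : continuous f -> continuous g ->
  L (fun x => f x - g x) = L f - L g.
Proof.
move=> cf cg; rewrite addrC -mulN1r -Llin//; congr L.
by apply/funext => x; rewrite mulN1r addrC.
Qed.

Let le_L (f g : X -> R) : continuous f -> continuous g -> (forall x, f x <= g x) ->
  L f <= L g.
Proof.
move=> cf cg fg; rewrite -subr_ge0 -LB//; apply: Lpos; first exact: cB.
by move=> x; rewrite subr_ge0.
Qed.

Let L1_ge0 : 0 <= L (fun _ => 1).
Proof. by apply: Lpos => //; exact: ccst. Qed.

Definition cut (e : R) (f : X -> R) := fun x => Num.max (f x - e) 0.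

Let ccut (e : R) (f : X -> R) : continuous f -> continuous (cut e f).
Proof.
move=> cf x; apply: (@continuous_max _ _ (fun x => f x - e : R^o) (fun=> 0)).
  by apply: cB => //; exact: ccst.
exact: cvg_cst.
Qed.

Let le_L_cut (e : R) (f : X -> R) : 0 <= e -> continuous f ->
  L f <= L (cut e f) + e * L (fun _ => 1).
Proof.
move=> e0 cf; rewrite -LZ; last exact: ccst.
rewrite -LD; [|exact: ccut|by apply: cM; exact: ccst].
apply: le_L => //; first by apply: cD; [exact: ccut|apply: cM; exact: ccst].
by move=> x; rewrite mulr1 -lerBlDr le_max lexx.
Qed.

(** Weaker than the usual relation, which asks for compact support inside [U]; compactness is
    recovered by replacing [f] with [cut e f], which lowers [L f] by at most [e] times the total
    mass. *)
Definition below (U : set X) (f : X -> R) :=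
  [/\ continuous f, forall x, 0 <= f x <= 1 & forall x, ~ U x -> f x = 0].

Let below_cut (U : set X) (e : R) (f : X -> R) : 0 <= e -> below U f -> below U (cut e f).
Proof.
move=> e0 [cf f01 fU]; split; first exact: ccut.
  move=> x; rewrite le_max lexx orbT ge_max ler01 andbT.
  by case/andP: (f01 x) => ? f1; rewrite lerBlDr (le_trans f1)// lerDl.
by move=> x /fU; rewrite /cut => ->; rewrite sub0r; apply/max_idPr; rewrite oppr_le0.
Qed.

Local Open Scope ereal_scope.

(** Meant for open [U], where it is the value of the measure to be built; [outer_value] carries it
    to all sets as an outer measure, to which Caratheodory's construction applies. *)
Definition inner_value (U : set X) : \bar R :=
  ereal_sup [set (L f)%:E | f in below U].

Definition outer_value (E : set X) : \bar R :=
  ereal_inf [set inner_value U | U in [set U | open U /\ E `<=` U]].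

Let ivE U f : below U f -> (L f)%:E <= inner_value U.
Proof. by move=> Uf; apply: ereal_sup_ubound; exists f. Qed.

Let iv_ge0 U : 0 <= inner_value U.
Proof.
have b0 : below U (fun _ => 0%R).
  by split=> [|x|//]; [exact: ccst|rewrite lexx ler01].
by rewrite (le_trans _ (ivE b0))// L0.
Qed.

Let iv_le1 U : inner_value U <= (L (fun _ => 1%R))%:E.
Proof.
apply: ge_ereal_sup => _ [f [cf f1 fU] <-]; rewrite lee_fin; apply: le_L => //.
by move=> x; case/andP: (f1 x).
Qed.

Let iv_setT : inner_value setT = (L (fun _ => 1%R))%:E.
Proof.
apply/eqP; rewrite eq_le iv_le1 ivE//; split=> [|x|x /(_ I)//]; first exact: ccst.
by rewrite ler01 lexx.
Qed.

Let le_iv U V : U `<=` V -> inner_value U <= inner_value V.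
Proof.
move=> UV; apply: ge_ereal_sup => _ [f [cf f1 fU] <-]; apply: ivE; split => //.
by move=> x Vx; apply: fU => /UV.
Qed.

Let iv0 : inner_value set0 = 0.
Proof.
apply/eqP; rewrite eq_le iv_ge0 andbT; apply: ge_ereal_sup => _ [f [cf f1 f0] <-].
by rewrite (_ : f = fun=> 0%R) ?L0//; apply/funext => x; exact: f0.
Qed.

(* [cut e f] vanishes off the compact set [e <= f] even if [f] does not have
   compact support. *)
Let le_cut_le (f : X -> R) y : continuous f ->
  (forall e : R, (0 < e)%R -> (L (cut e f))%:E <= y) -> (L f)%:E <= y.
Proof.
move=> cf h; apply/lee_addgt0Pr => e e0.
pose d := (e / (L (fun _ => 1) + 1))%R.
have L1 : (0 < L (fun _ => 1%R) + 1)%R by rewrite ltr_wpDl.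
have d0 : (0 < d)%R by rewrite divr_gt0.
apply: (@le_trans _ _ ((L (cut d f))%:E + e%:E)); last by rewrite leeD2r// h.
rewrite -EFinD lee_fin (le_trans (le_L_cut (ltW d0) cf))// lerD2l.
by rewrite /d mulrAC ler_pdivrMr// ler_wpM2l// ?ltW// ltrDl.
Qed.

Let open_gt (f : X -> R) (c : R) : continuous f -> open [set x | (c < f x)%R].
Proof. by move=> cf; apply: (@open_comp _ _ f [set y | (c < y)%R]) => //; exact: open_gt. Qed.

Let closed_ge (f : X -> R) (c : R) : continuous f -> closed [set x | (c <= f x)%R].
Proof.
by move=> cf; apply: (@closed_comp _ _ f [set y | (c <= y)%R]) => //; exact: closed_ge.
Qed.

Let closed_compactT (A : set X) : closed A -> compact A.
Proof. by move=> cA; exact: subclosed_compact KX (@subsetT _ _). Qed.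

Let separate (A B : set X) : closed A -> closed B -> A `&` B = set0 ->
  exists f : X -> R, [/\ continuous f, forall x, (0 <= f x <= 1)%R,
    forall x, A x -> f x = 0%R & forall x, B x -> f x = 1%R].
Proof.
move=> cA cB' AB.
have /(uniform_separatorP (R:=R)) : uniform_separator A B.
  by move/(@normal_separatorP R): (compact_normal HX KX); apply.
move=> [f [cf f01 fA fB]]; exists f; split=> //.
- by move=> x; have := f01 (f x) (ex_intro2 _ _ x I erefl); rewrite /= in_itv.
- by move=> x Ax; apply: fA; exists x.
- by move=> x Bx; apply: fB; exists x.
Qed.

(** A Urysohn function [g], equal to 0 off [U] and to 1 on the part of [{e <= f}] outside [V],
    splits [cut e f] into [g * cut e f], which is below [U], and [(1 - g) * cut e f], which is below
    [V]. The two closed sets are disjoint because [e > 0] and [f] vanishes off the union. *)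
Let ivU U V : open U -> open V ->
  inner_value (U `|` V) <= inner_value U + inner_value V.
Proof.
move=> oU oV; apply: ge_ereal_sup => _ [f [cf f01 fUV] <-].
apply: le_cut_le => // e e0.
have [g [cg g01 gU gK]] : exists g : X -> R, [/\ continuous g, forall x, (0 <= g x <= 1)%R,
    forall x, (~` U) x -> g x = 0%R &
    forall x, ([set x | (e <= f x)%R] `&` ~` V) x -> g x = 1%R].
  apply: separate.
  - exact: open_closedC.
  - by apply: closedI; [exact: closed_ge|exact: open_closedC].
  - apply/seteqP; split=> // x [nU [/= ef nV]].
    by move: ef; rewrite fUV ?leNgt ?e0// => -[].
have [cc c01 cUV] : below (U `|` V) (cut e f) by apply: below_cut => //; exact: ltW.
have -> : cut e f = (fun x => g x * cut e f x + (1 - g x) * cut e f x)%R.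
  by apply/funext => x; rewrite -mulrDl addrC subrK mul1r.
have c1g : continuous (fun x => 1 - g x)%R by apply: cB => //; exact: ccst.
rewrite LD//; [|exact: cM|exact: cM].
rewrite EFinD leeD//; apply: ivE; split.
- exact: cM.
- move=> x; move: (g01 x) (c01 x) => /andP[? ?] /andP[? ?].
  by rewrite mulr_ge0// mulr_ile1.
- by move=> x /gU ->; rewrite mul0r.
- exact: cM.
- move=> x; move: (g01 x) (c01 x) => /andP[? ?] /andP[? ?].
  by rewrite mulr_ge0 ?subr_ge0// mulr_ile1 ?subr_ge0// lerBlDr lerDl.
- move=> x nV; have [ef|ef] := leP e (f x); first by rewrite gK// subrr mul0r.
  by rewrite /cut (max_idPr _) ?mulr0// subr_le0 ltW.
Qed.

Let iv_bigcup (U : (set X)^nat) : (forall n, open (U n)) ->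
  inner_value (\bigcup_n U n) <= \sum_(n <oo) inner_value (U n).
Proof.
move=> oU; apply: ge_ereal_sup => _ [f bf <-]; have [cf f01 fU] := bf.
apply: le_cut_le => // e e0.
have [N HN] : exists N, forall x, (e <= f x)%R -> (\bigcup_(i < N) U i) x.
  (* Compactness in near-covering form: each point of [{e <= f}] has a neighbourhood inside some
     [U n], hence inside all partial unions from index [n.+1] on, and compactness makes the index
     uniform. *)
  have /compact_near_coveringP := closed_compactT (@closed_ge f e cf).
  move=> /(_ nat \oo (fun n x => (\bigcup_(i < n) U i) x)).
  case.
    move=> x /= ef.
    have [n _ Unx] : (\bigcup_n U n) x.
      by apply: contrapT => /fU fx; move: ef; rewrite fx leNgt e0.
    near=> x' i => /=; exists n => //=; first by near: i; exists n.+1.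
    by near: x'; apply: open_nbhs_nbhs; split.
  by move=> N _ hN; exists N => x ex; apply: (hN N) => //=.
have bc : below (\bigcup_(i < N) U i) (cut e f).
  have [? ? _] := below_cut (ltW e0) bf; split=> // x nx.
  rewrite /cut (max_idPr _)// subr_le0 leNgt; apply/negP => /ltW /HN.
  exact: nx.
apply: (le_trans (ivE bc)).
apply: (@le_trans _ _ (\sum_(0 <= i < N) inner_value (U i))); last first.
  by apply: nneseries_lim_ge => n _ _; exact: iv_ge0.
rewrite big_mkord bigcup_mkord; elim: N {HN bc} => [|N IH].
  by rewrite !big_ord0 iv0.
rewrite !big_ord_recr/= (le_trans (ivU _ _))// ?leeD2r//.
by apply: big_ind => //; [exact: open0|move=> ? ?; exact: openU].
Unshelve. all: by end_near. Qed.

Let ov_le E U : open U -> E `<=` U -> outer_value E <= inner_value U.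
Proof. by move=> oU EU; apply: ereal_inf_lbound; exists U. Qed.

Let ov_open U : open U -> outer_value U = inner_value U.
Proof.
move=> oU; apply/eqP; rewrite eq_le ov_le//=.
by apply: le_ereal_inf_tmp => _ [V [oV UV] <-]; exact: le_iv.
Qed.

Let ov_ge0 E : 0 <= outer_value E.
Proof. by apply: le_ereal_inf_tmp => _ [V [oV UV] <-]; exact: iv_ge0. Qed.

Let ov_fin E : outer_value E \is a fin_num.
Proof.
rewrite ge0_fin_numE ?ov_ge0// (@le_lt_trans _ _ (inner_value setT))//.
  by apply: ov_le => //; exact: openT.
by rewrite iv_setT ltry.
Qed.

Let ov_adherent E (e : R) : (0 < e)%R ->
  exists U, [/\ open U, E `<=` U & inner_value U <= outer_value E + e%:E].
Proof.
move=> e0; have [_ [U [oU EU] <-] h] := lb_ereal_inf_adherent e0 (ov_fin E).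
by exists U; split => //; exact: ltW.
Qed.

Let ov0 : outer_value set0 = 0.
Proof. by rewrite ov_open ?iv0//; exact: open0. Qed.

Let le_ov : {homo outer_value : A B / A `<=` B >-> A <= B}.
Proof.
move=> A B AB; apply: le_ereal_inf_tmp => _ [V [oV BV] <-].
by apply: ov_le => //; exact: subset_trans BV.
Qed.

Let ov_sigma_subadditive : sigma_subadditive outer_value.
Proof.
move=> F; apply/lee_addgt0Pr => e e0.
apply: le_trans (epsilon_trick _ _ (ltW e0)); last by move=> n; exact: ov_ge0.
have e2 n : (0 < e / (2 ^ n.+1)%:R)%R by rewrite divr_gt0// ltr0n expn_gt0.
have /choice[U HU] : forall n, exists U, [/\ open U, F n `<=` U &
    inner_value U <= outer_value (F n) + (e / (2 ^ n.+1)%:R)%:E].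
  by move=> n; exact: ov_adherent.
apply: (@le_trans _ _ (\sum_(n <oo) inner_value (U n))); last first.
  by apply: lee_nneseries => [n _ _|n _]; [exact: iv_ge0|case: (HU n)].
apply: le_trans (iv_bigcup _); last by move=> n; case: (HU n).
apply: ov_le.
  by apply: bigcup_open => n _; case: (HU n).
by apply: subset_bigcup => n _; case: (HU n).
Qed.

Let om : {outer_measure set X -> \bar R} := HB.pack outer_value
  (isOuterMeasure.Build R X outer_value ov0 ov_ge0 le_ov ov_sigma_subadditive).

(** By definition of [outer_value], [E] may be replaced with an open [V]. If [f] is below the
    intersection of [V] and [U], and [g] is below [V] minus [{d <= f}], then [cut d f] and [g] are
    never both nonzero, so their sum is still below [V]. *)
Let open_caratheodory (U : set X) : open U -> om.-caratheodory U.
Proof.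
move=> oU; apply: le_caratheodory_measurable => E.
apply/lee_addgt0Pr => e e0; have [V [oV EV hV]] := ov_adherent E e0.
apply: le_trans hV.
apply: (@le_trans _ _ (outer_value (V `&` U) + outer_value (V `&` ~` U))).
  by apply: leeD; apply: le_ov; exact: setSI.
rewrite -leeBrDr// ov_open; last exact: openI.
apply: ge_ereal_sup => _ [f bf <-]; have [cf f01 fVU] := bf.
apply: le_cut_le => // d d0; have [cc c01 cVU] := below_cut (ltW d0) bf.
rewrite leeBrDr// addeC -leeBrDr//.
apply: (@le_trans _ _ (inner_value (V `&` ~` [set x | (d <= f x)%R]))).
  apply: ov_le; first by apply: openI => //; apply/closed_openC/closed_ge.
  move=> x [Vx nUx]; split => //= df; move: df.
  by rewrite fVU ?leNgt ?d0// => -[].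
apply: ge_ereal_sup => _ [g [cg g01 gV] <-].
rewrite leeBrDr// -EFinD -LD//; apply: ivE; split; first exact: cD.
  move=> x; move: (g01 x) (c01 x) => /andP[? ?] /andP[? ?].
  rewrite addr_ge0//=; have [df|/ltW df] := leP d (f x).
    by rewrite gV ?add0r// => -[].
  by rewrite /cut (max_idPr _) ?addr0// subr_le0.
by move=> x nV; rewrite gV ?cVU ?addr0// => -[].
Qed.

Let borel_caratheodory (E : set (BorelT X)) : measurable E -> om.-caratheodory E.
Proof.
have sa : sigma_algebra setT om.-caratheodory.
  split.
  - exact: caratheodory_measurable_set0.
  - by move=> A mA; rewrite setTD; exact: caratheodory_measurable_setC.
  - exact: caratheodory_measurable_bigcup.
move: E; apply: smallest_sub => //; exact: open_caratheodory.
Qed.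

Let m_sigma_additive : semi_sigma_additive (outer_value : set (BorelT X) -> \bar R).
Proof.
move=> F mF tF mUF.
apply: (@caratheodory_measure_sigma_additive R X om) => //; last first.
  exact: borel_caratheodory.
by move=> i; exact: (borel_caratheodory (mF i)).
Qed.

Let m : {measure set (BorelT X) -> \bar R} := HB.pack (outer_value : set (BorelT X) -> \bar R)
  (isMeasure.Build _ (BorelT X) R outer_value ov0 ov_ge0 m_sigma_additive).


Let m_regular : finite_regular m.
Proof.
have mT : m setT = (L (fun _ => 1%R))%:E by rewrite -iv_setT; exact: (ov_open openT).
have outer (E : set X) (e : R) : (0 < e)%R ->
    exists U, [/\ open U, E `<=` U & m U <= m E + e%:E].
  by move=> /(ov_adherent E)[U [oU EU h]]; exists U; split => //; rewrite [m U]ov_open.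
split; first by rewrite /finite_measure mT ltry.
move=> E mE; split; apply/eqP; rewrite eq_le; apply/andP; split.
- by apply: le_ereal_inf_tmp => _ [U [oU EU] <-]; exact: le_ov.
- apply/lee_addgt0Pr => e /(outer E)[U [oU EU hU]].
  by apply: le_trans hU; apply: ereal_inf_lbound; exists U.
(* Inner regularity by complementation: the complement of an open set containing the complement of
   [E] is a closed, hence compact, subset of [E]. *)
- apply/lee_addgt0Pr => e /(outer (~` E))[U [oU EU hU]].
  have mU := open_borel_measurable oU.
  apply: (@le_trans _ _ (m (~` U) + e%:E)); last first.
    apply: leeD2r; apply: ereal_sup_ubound; exists (~` U) => //; split.
      by apply: closed_compactT; exact: open_closedC.
    by rewrite -[E]setCK; exact: subsetC.
  have fm A : m A \is a fin_num by exact: ov_fin.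
  have compl A : measurable A -> m (~` A) = m setT - m A.
    by move=> mA; rewrite -setTD measureD// ?setTI// ltey_eq fm.
  move: hU; rewrite !compl// -(fineK (fm setT)) -(fineK (fm U)) -(fineK (fm E)).
  by rewrite -!EFinB -!EFinD !lee_fin; lra.
- by apply: ge_ereal_sup => _ [K [cK KE] <-]; exact: le_ov.
Qed.

Let fm A : m A \is a fin_num. Proof. exact: ov_fin. Qed.

Let mT : m setT = (L (fun _ => 1%R))%:E.
Proof. by rewrite -iv_setT; exact: (ov_open openT). Qed.

Local Open Scope ring_scope.

Let cmin (f : X -> R) (c : R) : continuous f -> continuous (fun x => Num.min (f x) c).
Proof.
move=> cf x; apply: (@continuous_min _ _ (f : X -> R^o) (fun=> c)).
  exact: cf.
exact: cvg_cst.
Qed.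

Let int_cont (f : X -> R) : continuous f -> m.-integrable setT (EFin \o f).
Proof.
move=> cf; have [M _ fM] := compact_continuous_bounded KX cf.
apply: (@bounded_integrable _ (BorelT X) _ m f M) => //.
  by rewrite mT ltry.
exact: continuous_borel_measurable.
Qed.

(* One slice of the layer-cake decomposition of [f]. *)
Let layer (f : X -> R) (a b : R)
    (g := fun x => Num.min (f x) b - Num.min (f x) a) :
  continuous f -> a < b ->
  L g - \int[m]_x g x <=
    (b - a) * (fine (m [set x | a < f x]) - fine (m [set x | b < f x])).
Proof.
move=> cf ab.
have cg : continuous g by apply: cB; exact: cmin.
have ba : 0 < b - a by rewrite subr_gt0.
have g01 x : 0 <= g x <= b - a.
  by rewrite /g; case: (leP (f x) b) => ?; case: (leP (f x) a) => ?; lra.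
rewrite mulrBr; apply: lerB.
  (* [g / (b - a)] is below [{a < f}], which bounds [L g] from above; the integral is bounded from
     below because [g = b - a] on [{b < f}]. *)
  rewrite -ler_pdivrMl// -LZ// -lee_fin fineK//.
  rewrite [m _]ov_open; last exact: open_gt.
  apply: ivE; split.
  - by apply: cM => //; exact: ccst.
  - move=> x; have /andP[g0 g1] := g01 x.
    by rewrite mulr_ge0 ?invr_ge0 ?(ltW ba)//= ler_pdivrMl ?mulr1.
  - move=> x /= /negP; rewrite -leNgt => fa; rewrite /g.
    by rewrite (min_idPl _) ?(min_idPl fa) ?subrr ?mulr0// (le_trans fa)// ltW.
have mb : measurable ([set x | b < f x] : set (BorelT X)).
  by apply: open_borel_measurable; exact: open_gt.
have <- : \int[m]_(x in [set x | b < f x]) (b - a) = (b - a) * fine (m [set x | b < f x]).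
  by rewrite Rintegral_cst.
rewrite Rintegral_mkcond; apply: le_Rintegral => //.
- rewrite -restrict_EFin; apply/integrable_restrict => //; rewrite setTI.
  apply: (@integrableS _ _ _ _ setT) => //; exact: int_cont.
- exact: int_cont.
- move=> x _; rewrite patchE; case: ifPn => [|_]; last by case/andP: (g01 x).
  by rewrite inE /= /g => bf; rewrite (min_idPr (ltW bf)) (min_idPr _)// ltW// (lt_trans ab).
Qed.

(** The layers between [- M] and [M], of height [h = 2 * M / n.+1], have error bounds that telescope
    to at most [h] times the total mass, which is small for large [n]. One inequality is enough,
    since it can also be applied to [- f]. *)
Let L_le_int (f : X -> R) : continuous f -> L f <= \int[m]_x f x.
Proof.
move=> cf; have [M M0 fM] := compact_continuous_bounded KX cf.
rewrite -subr_le0; apply/ler_addgt0Pr => e e0; rewrite add0r.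
pose C := 2 * M * L (fun=> 1).
have C0 : 0 <= C by rewrite mulr_ge0// mulr_ge0// ltW.
have [n Cn] : exists n, C / n.+1%:R < e.
  exists (Num.bound (C / e)); rewrite ltr_pdivrMr ?ltr0n// mulrC -ltr_pdivrMr//.
  have := archi_boundP (divr_ge0 C0 (ltW e0)) => /lt_le_trans -> //.
  by rewrite ler_nat.
pose h := 2 * M / n.+1%:R.
have h0 : 0 < h by rewrite divr_gt0// mulr_gt0.
pose t k := - M + k%:R * h.
pose U k := [set x | t k < f x].
have H k : L (fun x => Num.min (f x) (t k)) - \int[m]_x Num.min (f x) (t k) <=
    h * (fine (m (U 0%N)) - fine (m (U k))).
  elim: k => [|k IH].
    rewrite subrr mulr0 (_ : (fun x => _) = (fun=> t 0%N * 1)); last first.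
      apply/funext => x; rewrite mulr1 /t mul0r addr0; apply/min_idPr.
      by have := fM x; rewrite ler_norml => /andP[].
    rewrite LZ; last exact: ccst.
    by rewrite mulr1 Rintegral_cst// mT subrr.
  have tk : t k < t k.+1 by rewrite ltrD2l ltr_pM2r// ltr_nat.
  have := layer cf tk; rewrite /= LB; [|exact: cmin..].
  rewrite RintegralB//; [|by apply: int_cont; exact: cmin..].
  have -> : t k.+1 - t k = h.
    by rewrite /t opprD addrACA subrr add0r -mulrBl -natrB// subSnn mul1r.
  rewrite -/(U k) -/(U k.+1) => ?; lra.
have tn : t n.+1 = M by rewrite /t /h mulrC divfK ?pnatr_eq0//; lra.
have := H n.+1; rewrite tn.
have -> : (fun x => Num.min (f x) M) = f.
  apply/funext => x; apply/min_idPl; rewrite (le_trans _ (fM x))//; exact: ler_norm.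
move=> /le_trans; apply.
apply: (le_trans _ (ltW Cn)); have -> : C / n.+1%:R = h * L (fun=> 1) by rewrite [RHS]mulrAC.
apply: ler_wpM2l; first exact: ltW.
have := fine_ge0 (ov_ge0 (U n.+1)); rewrite -[outer_value _]/(m _).
have : fine (m (U 0%N)) <= L (fun=> 1).
  by rewrite -lee_fin fineK// -mT; exact: le_ov.
lra.
Qed.

Theorem riesz_markov : exists m : {measure set (BorelT X) -> \bar R},
  finite_regular m /\ forall f, continuous f -> L f = \int[m]_x f x.
Proof.
exists m; split=> [|f cf]; first exact: m_regular.
apply/eqP; rewrite eq_le L_le_int//=.
have cNf : continuous (fun x => - 1 * f x) by apply: cM => //; exact: ccst.
have := L_le_int cNf; rewrite LZ// RintegralZl//; last exact: int_cont.
lra.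
Qed.
End riesz_markov.

(** * Completeness of [L^2] and orthogonal projections *)

Lemma cvg_mul_exp2V (R : realType) (c : R) : c * (2 ^+ n)^-1 @[n --> \oo] --> (0 : R).
Proof.
under eq_fun do rewrite -exprVn.
by apply: cvg_geometric; rewrite ger0_norm ?invr_ge0// invf_lt1// ltr1n.
Qed.

Lemma mul_exp2V_small (R : realType) (c e : R) : 0 < e ->
  exists n, c * (2 ^+ n)^-1 < e.
Proof.
move=> e0; have /cvgrPdist_lt/(_ e e0)[n _ /(_ n (leqnn n))/=] := cvg_mul_exp2V c.
by rewrite sub0r normrN => h; exists n; apply: le_lt_trans (ler_norm _) h.
Qed.

Section L2_real.
Context {d} {T : measurableType d} {R : realType}.
Variable m : {measure set T -> \bar R}.

(** The series [S] of the squared increments weighted by [2^(n+1)] has integral at most 1, and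
    pointwise [(u (n + j) - u n)^2 <= 2^-n * S]. This single bound gives convergence where [S] is
    finite and, after a passage to the limit and an integration, the rate in [L^2]. *)
Lemma L2_real_complete (u : nat -> T -> R) :
  (forall n, measurable_fun setT (u n)) ->
  (forall n, (\int[m]_x ((u n.+1 x - u n x) ^+ 2)%:E <= ((4 ^+ n.+1)^-1)%:E)%E) ->
  exists v : T -> R, measurable_fun setT v /\
    forall n, (\int[m]_x ((u n x - v x) ^+ 2)%:E <= ((2 ^+ n)^-1)%:E)%E.
Proof.
move=> mu hu.
pose w n x := 2 ^+ n.+1 * (u n.+1 x - u n x) ^+ 2.
have w0 n x : 0 <= w n x by rewrite mulr_ge0 ?sqr_ge0// exprn_ge0.
have mw n : measurable_fun setT (w n).
  by apply: measurable_funM => //; apply: measurable_funX; exact: measurable_funB.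
pose S x := (\sum_(n <oo) (w n x)%:E)%E.
have mS : measurable_fun setT S.
  apply: ge0_emeasurable_sum => [n x _ _|n _]; first by rewrite lee_fin.
  exact/measurable_EFinP.
have S0 x : (0 <= S x)%E by apply: nneseries_ge0 => n _ _; rewrite lee_fin.
have intS : (\int[m]_x S x <= 1%:E)%E.
  rewrite integral_nneseries//; [|by move=> n; exact/measurable_EFinP
    |by move=> n x _; rewrite lee_fin].
  apply: le_trans (@epsilon_trick0 R 1 xpredT ler01).
  apply: lee_nneseries => [n _ _|n _].
    by apply: integral_ge0 => x _; rewrite lee_fin.
  under eq_integral do rewrite /w EFinM.
  rewrite ge0_integralZl_EFin//; last 2 first.
  - by move=> x _; rewrite lee_fin sqr_ge0.
  - by apply/measurable_EFinP; apply: measurable_funX; exact: measurable_funB.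
  apply: (@le_trans _ _ ((2 ^+ n.+1)%:E * ((4 ^+ n.+1)^-1)%:E)%E).
    by apply: lee_wpmul2l => //; rewrite lee_fin exprn_ge0.
  rewrite -EFinM lee_fin div1r natrX -!exprVn -exprMn.
  by rewrite (_ : 2 * 4^-1 = 2^-1 :> R)//; lra.
(* [(a + b)^2 <= 2 a^2 + 2 b^2] at each step; the factors 2 are absorbed by [w]. *)
have tele j n x : 2 ^+ n * (u (n + j)%N x - u n x) ^+ 2 <= \sum_(n <= k < n + j) w k x.
  elim: j n => [|j IH] n; first by rewrite addn0 subrr expr0n mulr0 big_geq.
  rewrite big_ltn ?addnS ?ltnS ?leq_addr// -addSn.
  apply: le_trans (lerD (lexx _) (IH n.+1)).
  rewrite /w [2 ^+ n.+1]exprS; have : 0 <= 2 ^+ n :> R by rewrite exprn_ge0.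
  set p := 2 ^+ n => p0.
  have := mulr_ge0 p0 (sqr_ge0 ((u (n.+1 + j)%N x - u n.+1 x) - (u n.+1 x - u n x))).
  rewrite !expr2; lra.
pose E := [set x | (S x < +oo)%E].
have teleS j n x : E x -> (u (n + j)%N x - u n x) ^+ 2 <= (2 ^+ n)^-1 * fine (S x).
  move=> Ex; rewrite ler_pdivlMl ?exprn_gt0// (le_trans (tele _ _ _))//.
  rewrite -lee_fin fineK ?ge0_fin_numE// -sumEFin.
  apply: le_trans (nneseries_lim_ge (n + j) _); last by move=> k _ _; rewrite lee_fin.
  rewrite [leRHS](@big_cat_nat _ _ _ n)//= ?leq_addr// leeDr//.
  by apply: sume_ge0 => k _; rewrite lee_fin.
have cvgu x : E x -> cvgn (u ^~ x).
  move=> Ex; apply/cauchy_cvgP/cauchyP => e e0.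
  have [n hn] := mul_exp2V_small (fine (S x)) (exprn_gt0 2 e0).
  exists (u n x); exists n => // k /= nk.
  rewrite -ball_normE /= -(subnKC nk) distrC -ltr_sqr ?nnegrE ?(ltW e0)//.
  by rewrite real_normK ?num_real// (le_lt_trans (teleS _ _ _ Ex))// mulrC.
pose v x := if (S x < +oo)%E then limn (u ^~ x) else 0.
have mE : measurable_fun setT (fun x => S x < +oo)%E.
  exact: measurable_fun_lte.
have cvgv x : (if (S x < +oo)%E then u n x else 0) @[n --> \oo] --> v x.
  rewrite /v; case: ifPn => Ex; first exact: cvgu.
  exact: cvg_cst.
have mv : measurable_fun setT v.
  apply: (@measurable_fun_cvg _ _ _ _ (fun n x => if (S x < +oo)%E then u n x else 0)).
    by move=> n; apply: measurable_fun_ifT => //; exact: mu.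
  by move=> x _; exact: cvgv.
exists v; split; [exact: mv|move=> n].
apply: (@le_trans _ _ (\int[m]_x (((2 ^+ n)^-1)%:E * S x))%E); last first.
  rewrite ge0_integralZl_EFin//.
  by rewrite -[leRHS]mule1; apply: lee_wpmul2l.
apply: ge0_le_integral => //.
- by move=> x _; rewrite lee_fin sqr_ge0.
- by apply/measurable_EFinP; apply: measurable_funX; exact: measurable_funB.
- exact: measurable_funeM.
(* Where [S] is infinite the right-hand side is [+oo], so the default value 0 of [v] is harmless
   there and no almost-everywhere argument arises. *)
move=> x _; have [Ex|] := boolP (S x < +oo)%E; last first.
  rewrite -leNgt leye_eq => /eqP ->.
  by rewrite gt0_muley ?leey// lte_fin invr_gt0 exprn_gt0.
rewrite -[S x]fineK ?ge0_fin_numE// -EFinM lee_fin.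
rewrite -sqrrN opprB.
have cv2 : (u k x - u n x) ^+ 2 @[k --> \oo] --> (v x - u n x) ^+ 2.
  rewrite expr2; under eq_fun do rewrite expr2.
  have cvx : u k x - u n x @[k --> \oo] --> v x - u n x.
    by apply: cvgB; [have := @cvgv x; rewrite Ex|exact: cvg_cst].
  exact: cvgM.
rewrite -(cvg_lim _ cv2)//; apply: limr_le; first by apply/cvg_ex; eexists; exact: cv2.
by exists n => // k /= nk; rewrite -(subnKC nk); exact: teleS.
Qed.

End L2_real.

(** The first-order condition at a minimum. At [t = a / (b + 1)] the hypothesis reads
    [t^2 * (b + 1) <= t^2 * b], which forces [t = 0]; the denominator [b + 1] also covers
    [b = 0]. *)
Lemma linear_le_quadratic_eq0 (R : realFieldType) (a b : R) :
  (forall t, t * a <= t ^+ 2 * b) -> a = 0.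
Proof.
move=> h; have b0 : 0 <= b by have := h 1; have := h (-1); rewrite !expr2; lra.
have b1 : 0 < b + 1 by rewrite ltr_wpDl.
have [t at_] : exists t, a = t * (b + 1).
  by exists (a / (b + 1)); rewrite divfK// gt_eqF.
suff t0 : t = 0 by rewrite at_ t0 mul0r.
apply/eqP; rewrite -sqrf_eq0 eq_le sqr_ge0 andbT.
by have := h t; rewrite at_ !expr2; lra.
Qed.

Section hilbert_projection.
Context {R : realType} {V : lmodType R}.
Variables (D H : set V) (B : V -> V -> R).
Hypotheses (Dlin : forall (a : R) u v, D u -> D v -> D (a *: u + v))
  (Blin : forall (a : R) u v w, D u -> D v -> D w ->
     B (a *: u + v) w = a * B u w + B v w)
  (Bsym : forall u v, B u v = B v u)
  (Bpos : forall u, 0 <= B u u)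
  (HD : H `<=` D) (H0 : H 0)
  (Hlin : forall (a : R) u v, H u -> H v -> H (a *: u + v))
  (Hcomplete : forall h : nat -> V, (forall n, H (h n)) ->
     (forall n, B (h n.+1 - h n) (h n.+1 - h n) <= (4 ^+ n.+1)^-1) ->
     exists2 g, H g & forall n, B (h n - g) (h n - g) <= 2 * (2 ^+ n)^-1).

Let Q u := B u u.

Let QD (t : R) u v : D u -> D v -> Q (t *: u + v) = t ^+ 2 * Q u + 2 * t * B u v + Q v.
Proof.
move=> Du Dv; rewrite /Q Blin//; last exact: Dlin.
by rewrite !(Bsym _ (t *: u + v)) !Blin// (Bsym v u); ring.
Qed.

Let DB u v : D u -> D v -> D (u - v).
Proof. by move=> Du Dv; rewrite addrC -scaleN1r; exact: Dlin. Qed.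

Let HB' u v : H u -> H v -> H (u - v).
Proof. by move=> Du Dv; rewrite addrC -scaleN1r; exact: Hlin. Qed.

(** Functions will be handled as representatives, so [B] is only semidefinite, and bilinear only on
    [D]. A minimising sequence for the distance from [f] to [H] is Cauchy by the parallelogram law;
    orthogonality is read off from the sequence, without showing that its limit [g] attains the
    infimum. *)
Lemma hilbert_projection f : D f ->
  exists2 g, H g & forall w, H w -> B (f - g) w = 0.
Proof.
move=> Df.
pose E := [set Q (f - h) | h in H].
have E0 : has_inf E.
  by split; [exists (Q (f - 0)), 0|exists 0 => _ [h _ <-]; exact: Bpos].
pose d := inf E.
have dle h : H h -> d <= Q (f - h).
  by move=> Hh; apply: ge_inf; [case: E0|exists h].
(* The parallelogram law bounds the squared increment by [2 * e n.+1 + 2 * e n <= 4 * e n], which is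
   the rate [4^-(n+1)] required by [Hcomplete]. *)
pose e n : R := (4 ^+ n.+1)^-1 / 4.
have e0 n : 0 < e n by rewrite divr_gt0// invr_gt0 exprn_gt0.
have /choice[h hP] : forall n, exists h, H h /\ Q (f - h) < d + e n.
  by move=> n; have [_ [h Hh <-] hd] := inf_adherent (e0 n) E0; exists h.
have Hh n : H (h n) by case: (hP n).
have hd n : Q (f - h n) < d + e n by case: (hP n).
have Dfh n : D (f - h n) by apply: DB => //; exact: HD.
have e_le n : e n.+1 <= e n.
  rewrite /e ler_pM2r ?invr_gt0// lef_pV2 ?posrE ?exprn_gt0//.
  by rewrite [leRHS]exprS ler_peMl ?exprn_ge0// ler1n.
have cauchy n : B (h n.+1 - h n) (h n.+1 - h n) <= (4 ^+ n.+1)^-1.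
  have := QD (- 1) (Dfh n.+1) (Dfh n); have := QD 1 (Dfh n.+1) (Dfh n).
  have -> : - 1 *: (f - h n.+1) + (f - h n) = h n.+1 - h n.
    by rewrite scaleN1r opprB addrA subrK.
  have : 4 * d <= Q (1 *: (f - h n.+1) + (f - h n)).
    have mid : H (2^-1 *: (1 *: h n.+1 + h n) + 0).
      by apply: Hlin => //; exact: Hlin.
    have := dle _ mid.
    have Dfh1 : D (1 *: (f - h n.+1) + (f - h n)) by exact: Dlin.
    have := QD 2^-1 Dfh1 Dfh1.
    have := QD (-1) Dfh1 Dfh1.
    rewrite scaleN1r addNr => q0.
    have D0 : D 0 by exact: HD.
    have := QD 2^-1 Dfh1 D0; rewrite addr0.
    have B0 : B (1 *: (f - h n.+1) + (f - h n)) 0 = 0.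
      by rewrite Bsym -[0]addr0 -[X in X + _](scaler0 _ 1) Blin//; have := Blin 1 D0 D0 Dfh1; rewrite scaler0 addr0; lra.
    have Q0 : Q 0 = 0.
      have := Blin 1 D0 D0 D0; rewrite scaler0 addr0 /Q; lra.
    have -> : 2^-1 *: (1 *: (f - h n.+1) + (f - h n)) = f - (2^-1 *: (1 *: h n.+1 + h n) + 0).
      rewrite !scale1r addr0 addrACA -opprD scalerBr; congr (_ - _).
      by rewrite -mulr2n -[f *+ 2]scaler_nat scalerA mulVf ?scale1r// pnatr_eq0.
    rewrite B0 Q0 => -> _; rewrite expr2; lra.
  have := hd n; have := hd n.+1; have := e_le n.
  have : (4 ^+ n.+1)^-1 = 4 * e n by rewrite /e; field; rewrite expf_neq0// pnatr_eq0.
  rewrite -/(Q _) !expr2; lra.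
have [g Hg gP] := Hcomplete Hh cauchy.
exists g => // w Hw; rewrite Bsym.
apply: (@linear_le_quadratic_eq0 _ _ (Q w)) => t.
suff : 2 * (t * B w (f - g)) <= 2 * (t ^+ 2 * Q w) by lra.
apply/ler_addgt0Pr => c c0.
(* Two inequalities get added: minimality of [d] tested at [t *: w + h n], and positivity of [Q] at
   [- t *: w + (h n - g)]. Each contributes [t^2 * Q w]; their errors are [e n <= 2^-n] and
   [2 * 2^-n], whence the 3. *)
have [n hn] := mul_exp2V_small 3 c0.
have Dw := HD Hw; have Dhg : D (h n - g) by apply: HD; exact: HB'.
have /dle : H (t *: w + h n) by exact: Hlin.
have -> : f - (t *: w + h n) = - t *: w + (f - h n).
  by rewrite scaleNr opprD addrCA.
rewrite QD// => h1.
have := Bpos (- t *: w + (h n - g)); rewrite -/(Q _) QD// => h2.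
have -> : B w (f - g) = B w (f - h n) + B w (h n - g).
  rewrite !(Bsym w) -[B (f - h n) w]mul1r -Blin// scale1r addrA subrK//.
have := gP n; have := hd n.
have : e n <= (2 ^+ n)^-1.
  rewrite /e ler_pdivrMr// (@le_trans _ _ ((2 ^+ n)^-1))//; last first.
    by rewrite ler_peMr ?invr_ge0 ?exprn_ge0// ler1n.
  rewrite lef_pV2 ?posrE ?exprn_gt0// (@le_trans _ _ (2 ^+ n.+1))//.
    by rewrite exprS ler_peMl ?exprn_ge0// ler1n.
  by rewrite lerXn2r// ?nnegrE// ler_nat.
rewrite -/(Q _) sqrrN in h1 h2 *; lra.
Qed.

End hilbert_projection.

Section integrable_real.
Context {d} {T : measurableType d} {R : realType}.
Variable m : {measure set T -> \bar R}.

Lemma integrable_dominated (f g : T -> R) : measurable_fun setT f ->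
  (forall x, `|f x| <= g x) -> m.-integrable setT (EFin \o g) ->
  m.-integrable setT (EFin \o f).
Proof.
move=> mf fg; apply: le_integrable => //; first exact/measurable_EFinP.
by move=> x _ /=; rewrite lee_fin (le_trans (fg x))// ler_norm.
Qed.

Lemma ge0_integrableP (f : T -> R) : (forall x, 0 <= f x) ->
  m.-integrable setT (EFin \o f) <->
  measurable_fun setT f /\ (\int[m]_x (f x)%:E < +oo)%E.
Proof.
move=> f0; have E : (\int[m]_x `|(EFin \o f) x| = \int[m]_x (f x)%:E)%E.
  by apply: eq_integral => x _; rewrite /= ger0_norm.
split=> [/integrableP[/measurable_EFinP mf]|[mf fi]]; first by rewrite E.
by apply/integrableP; split; [exact/measurable_EFinP|rewrite E].
Qed.

Lemma integrable_EFinD (f g : T -> R) : m.-integrable setT (EFin \o f) ->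
  m.-integrable setT (EFin \o g) ->
  m.-integrable setT (EFin \o (fun x => f x + g x)).
Proof. by move=> fi gi; exact: (integrableD measurableT fi gi). Qed.

Lemma integrable_EFinB (f g : T -> R) : m.-integrable setT (EFin \o f) ->
  m.-integrable setT (EFin \o g) ->
  m.-integrable setT (EFin \o (fun x => f x - g x)).
Proof. by move=> fi gi; exact: (integrableB measurableT fi gi). Qed.

Lemma integrable_EFinZ (a : R) (f : T -> R) : m.-integrable setT (EFin \o f) ->
  m.-integrable setT (EFin \o (fun x => a * f x)).
Proof. by move=> fi; exact: (integrableZl measurableT a fi). Qed.

Lemma integrable_sqr_mul (f g : T -> R) :
  measurable_fun setT f -> measurable_fun setT g ->
  m.-integrable setT (EFin \o (fun x => f x ^+ 2)) ->
  m.-integrable setT (EFin \o (fun x => g x ^+ 2)) ->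
  m.-integrable setT (EFin \o (fun x => f x * g x)).
Proof.
move=> mf mg fi gi; apply: integrable_dominated (integrable_EFinD fi gi).
  exact: measurable_funM.
move=> x; rewrite ler_norml -[f x ^+ 2]sqrrN.
have := sqr_ge0 (f x + g x); have := sqr_ge0 (f x - g x).
have := sqr_ge0 (f x); have := sqr_ge0 (g x).
by rewrite !expr2 => *; apply/andP; split; lra.
Qed.

End integrable_real.

Section complex_parts.
Context {R : realType}.
Implicit Types a b : R[i].

Lemma cabs_sqr a : cabs a ^+ 2 = complex.Re a ^+ 2 + complex.Im a ^+ 2.
Proof. by rewrite sqr_sqrtr// addr_ge0// sqr_ge0. Qed.

Lemma cabs_ge0 a : 0 <= cabs a. Proof. exact: sqrtr_ge0. Qed.

Lemma ReDE a b : complex.Re (a + b) = complex.Re a + complex.Re b.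
Proof. by case: a; case: b. Qed.
Lemma ImDE a b : complex.Im (a + b) = complex.Im a + complex.Im b.
Proof. by case: a; case: b. Qed.
Lemma ReNE a : complex.Re (- a) = - complex.Re a.
Proof. by case: a. Qed.
Lemma ImNE a : complex.Im (- a) = - complex.Im a.
Proof. by case: a. Qed.
Lemma ReME a b : complex.Re (a * b) =
  complex.Re a * complex.Re b - complex.Im a * complex.Im b.
Proof. by case: a; case: b. Qed.
Lemma ImME a b : complex.Im (a * b) =
  complex.Re a * complex.Im b + complex.Im a * complex.Re b.
Proof. by case: a; case: b. Qed.
Lemma ReJE a : complex.Re (conjc a) = complex.Re a.
Proof. by case: a. Qed.
Lemma ImJE a : complex.Im (conjc a) = - complex.Im a.
Proof. by case: a. Qed.
Lemma eq_ReIm a b : complex.Re a = complex.Re b -> complex.Im a = complex.Im b -> a = b.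
Proof. by case: a => ? ?; case: b => ? ? /= -> ->. Qed.

Definition ReIm := (ReDE, ImDE, ReNE, ImNE, ReME, ImME, ReJE, ImJE).

End complex_parts.

Section L2_projection.
Context {R : realType} {X : ptopologicalType}.
Local Notation T := (BorelT X).
Variable mu : {measure set T -> \bar R}.
Implicit Types f g h : X -> R[i].

Local Notation Ref f := (fun x : T => complex.Re (f x)).
Local Notation Imf f := (fun x : T => complex.Im (f x)).

Lemma L2P f : L2 mu f <-> [/\ measurable_fun setT (Ref f), measurable_fun setT (Imf f),
  mu.-integrable setT (EFin \o (fun x => Ref f x ^+ 2)) &
  mu.-integrable setT (EFin \o (fun x => Imf f x ^+ 2))].
Proof.
have E : (\int[mu]_x ((cabs (f x)) ^+ 2)%:E =
    \int[mu]_x (Ref f x ^+ 2 + Imf f x ^+ 2)%:E)%E.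
  by apply: eq_integral => x _; rewrite cabs_sqr.
have sq0 (x : T) : 0 <= Ref f x ^+ 2 + Imf f x ^+ 2 by rewrite addr_ge0// sqr_ge0.
split=> [[[mr mi]]|[mr mi ri ii]].
  rewrite E => fi.
  have /(ge0_integrableP mu sq0) si : measurable_fun setT (fun x : T => Ref f x ^+ 2 + Imf f x ^+ 2) /\
      (\int[mu]_x (Ref f x ^+ 2 + Imf f x ^+ 2)%:E < +oo)%E.
    by split=> //; apply: measurable_funD; exact: measurable_funX.
  split => //; apply: integrable_dominated si; try exact: measurable_funX.
    by move=> x; rewrite ger0_norm ?sqr_ge0// lerDl sqr_ge0.
  by move=> x; rewrite ger0_norm ?sqr_ge0// lerDr sqr_ge0.
split=> //; rewrite E.
by case: ((ge0_integrableP mu sq0).1 (integrable_EFinD ri ii)).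
Qed.

Lemma L2_integrable f g : L2 mu f -> L2 mu g ->
  [/\ mu.-integrable setT (EFin \o (fun x => Ref f x * Ref g x)),
      mu.-integrable setT (EFin \o (fun x => Ref f x * Imf g x)),
      mu.-integrable setT (EFin \o (fun x => Imf f x * Ref g x)) &
      mu.-integrable setT (EFin \o (fun x => Imf f x * Imf g x))].
Proof. by move=> /L2P[? ? ? ?] /L2P[? ? ? ?]; split; exact: integrable_sqr_mul. Qed.

(** The real part of [ip]: [L^2] is treated as a real space with a symmetric form, and [ipIE]
    recovers the imaginary part by testing against ['i * g]. *)
Let ipR f g := \int[mu]_x (Ref f x * Ref g x + Imf f x * Imf g x).

Let ipR_integrable f g : L2 mu f -> L2 mu g ->
  mu.-integrable setT (EFin \o (fun x => Ref f x * Ref g x + Imf f x * Imf g x)).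
Proof. by move=> f2 g2; have [? _ _ ?] := L2_integrable f2 g2; exact: integrable_EFinD. Qed.

Let ipRE f g : complex.Re (ip mu f g) = ipR f g.
Proof.
by apply: eq_Rintegral => x _; rewrite !ReIm mulrN opprK.
Qed.

Let ipIE f g : complex.Im (ip mu f g) = ipR f (fun x => 'i%C * g x).
Proof.
by apply: eq_Rintegral => x _ /=; rewrite !ReIm /=; ring.
Qed.

Let L2_lin (a : R) f g : L2 mu f -> L2 mu g -> L2 mu (fun x => a%:C%C * f x + g x).
Proof.
move=> f2 g2; have /L2P[? ? ? ?] := f2; have /L2P[? ? ? ?] := g2.
have [rr _ _ ii] := L2_integrable f2 g2.
have E (u v : X -> R) : (fun x => (a * u x + v x) ^+ 2) =
    (fun x => a ^+ 2 * u x ^+ 2 + (2 * a * (u x * v x) + v x ^+ 2)).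
  by apply/funext => x; ring.
have Er : Ref (fun x => a%:C%C * f x + g x) = (fun x => a * Ref f x + Ref g x).
  by apply/funext => x; rewrite !ReIm /=; ring.
have Ei : Imf (fun x => a%:C%C * f x + g x) = (fun x => a * Imf f x + Imf g x).
  by apply/funext => x; rewrite !ReIm /=; ring.
apply/L2P; split.
- by rewrite Er; apply: measurable_funD => //; exact: measurable_funM.
- by rewrite Ei; apply: measurable_funD => //; exact: measurable_funM.
- rewrite (_ : (fun x => _) = (fun x => (a * Ref f x + Ref g x) ^+ 2)); last first.
    by apply/funext => x; have /= -> := congr1 (@^~ x) Er.
  by rewrite E; apply: integrable_EFinD; [exact: integrable_EFinZ|
    apply: integrable_EFinD => //; exact: integrable_EFinZ].
- rewrite (_ : (fun x => _) = (fun x => (a * Imf f x + Imf g x) ^+ 2)); last first.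
    by apply/funext => x; have /= -> := congr1 (@^~ x) Ei.
  by rewrite E; apply: integrable_EFinD; [exact: integrable_EFinZ|
    apply: integrable_EFinD => //; exact: integrable_EFinZ].
Qed.

Lemma L2_complete (h : nat -> X -> R[i]) : (forall n, L2 mu (h n)) ->
  (forall n, (\int[mu]_x (cabs (h n.+1 x - h n x) ^+ 2)%:E <= ((4 ^+ n.+1)^-1)%:E)%E) ->
  exists2 g, L2 mu g &
    forall n, (\int[mu]_x (cabs (h n x - g x) ^+ 2)%:E <= (2 * (2 ^+ n)^-1)%:E)%E.
Proof.
move=> h2 hc.
have mr n : measurable_fun setT (Ref (h n)) by have /L2P[] := h2 n.
have mi n : measurable_fun setT (Imf (h n)) by have /L2P[] := h2 n.
have [u [mu_ uP]] : exists v : T -> R, measurable_fun setT v /\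
    forall n, (\int[mu]_x ((Ref (h n) x - v x) ^+ 2)%:E <= ((2 ^+ n)^-1)%:E)%E.
  apply: L2_real_complete => // n; apply: le_trans (hc n).
  apply: ge0_le_integral => //=.
  - by move=> x _; rewrite lee_fin sqr_ge0.
  - by apply/measurable_EFinP; apply: measurable_funX; exact: measurable_funB.
  - under eq_fun do rewrite cabs_sqr !ReIm.
    by apply/measurable_EFinP; apply: measurable_funD; apply: measurable_funX; exact: measurable_funB.
  - by move=> x _; rewrite lee_fin cabs_sqr !ReIm lerDl sqr_ge0.
have [v [mv vP]] : exists v : T -> R, measurable_fun setT v /\
    forall n, (\int[mu]_x ((Imf (h n) x - v x) ^+ 2)%:E <= ((2 ^+ n)^-1)%:E)%E.
  apply: L2_real_complete => // n; apply: le_trans (hc n).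
  apply: ge0_le_integral => //=.
  - by move=> x _; rewrite lee_fin sqr_ge0.
  - by apply/measurable_EFinP; apply: measurable_funX; exact: measurable_funB.
  - under eq_fun do rewrite cabs_sqr !ReIm.
    by apply/measurable_EFinP; apply: measurable_funD; apply: measurable_funX; exact: measurable_funB.
  - by move=> x _; rewrite lee_fin cabs_sqr !ReIm lerDr sqr_ge0.
have bound n : (\int[mu]_x (cabs (h n x - Complex (u x) (v x)) ^+ 2)%:E <=
    (2 * (2 ^+ n)^-1)%:E)%E.
  under eq_integral do rewrite cabs_sqr !ReIm /= EFinD.
  rewrite ge0_integralD//.
  - by rewrite mulr_natl mulr2n EFinD leeD.
  - by move=> x _; rewrite lee_fin sqr_ge0.
  - by apply/measurable_EFinP; apply: measurable_funX; exact: measurable_funB.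
  - by move=> x _; rewrite lee_fin sqr_ge0.
  - by apply/measurable_EFinP; apply: measurable_funX; exact: measurable_funB.
exists (fun x => Complex (u x) (v x)) => //.
(* The bound at index 0 makes the difference of [h 0] and the limit square integrable; subtracting
   it from [h 0] puts the limit itself in [L^2]. *)
have d2 : L2 mu (fun x => h 0%N x - Complex (u x) (v x)).
  split; last by rewrite (le_lt_trans (bound 0%N))// ltry.
  by split; under eq_fun do rewrite !ReIm /=; exact: measurable_funB.
have := L2_lin (-1) d2 (h2 0%N); congr (L2 mu _).
by apply/funext => x; apply: eq_ReIm; rewrite !ReIm /=; ring.
Qed.

Let L2_sub f g : L2 mu f -> L2 mu g -> L2 mu (fun x => f x - g x).
Proof.
move=> f2 g2; have := L2_lin (-1) g2 f2; congr (L2 mu _).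
by apply/funext => x; apply: eq_ReIm; rewrite !ReIm /=; ring.
Qed.

Let ipR_norm f : L2 mu f -> (\int[mu]_x (cabs (f x) ^+ 2)%:E = (ipR f f)%:E)%E.
Proof.
move=> f2; rewrite /ipR /Rintegral fineK.
  by apply: eq_integral => x _; rewrite cabs_sqr !expr2.
exact: integrable_fin_num (ipR_integrable f2 f2).
Qed.

Lemma orth_proj_exists (H : set (X -> R[i])) f : closed_L2_subspace mu H ->
  L2 mu f -> exists g, is_orth_proj mu H f g.
Proof.
move=> [HL2 [H0 [Hlin Hclosed]]] f2.
(* [Rcomplex R] is [R[i]] viewed as a real vector space; [sc] matches its scaling with
   multiplication by a complex number of imaginary part 0. *)
have sc (a : R) (u v : X -> Rcomplex R) :
    a *: u + v = (fun x => a%:C%C * u x + v x) :> (X -> R[i]).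
  apply/funext => x; rewrite [LHS](_ : _ = a *: u x + v x)//.
  by case: (u x) => p q; case: (v x) => r s; apply: eq_ReIm => /=; ring.
have [||||||||g Hg gP] := @hilbert_projection R (X -> Rcomplex R : lmodType R)
    (L2 mu) H ipR _ _ _ _ _ _ _ _ f f2.
- by move=> a u v u2 v2; rewrite sc; exact: L2_lin.
- move=> a u v w u2 v2 w2; rewrite sc.
  have iu := ipR_integrable u2 w2; have iv := ipR_integrable v2 w2.
  rewrite /ipR -RintegralZl// -RintegralD//; last exact: integrable_EFinZ.
  by apply: eq_Rintegral => x _; rewrite !ReIm /=; ring.
- by move=> u v; apply: eq_Rintegral => x _; congr (_ + _); rewrite mulrC.
- by move=> u; apply: Rintegral_ge0 => x _; rewrite -!expr2 addr_ge0// sqr_ge0.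
- exact: HL2.
- exact: H0.
- by move=> a u v Hu Hv; rewrite sc; exact: Hlin.
- move=> h Hh hc.
  have h2 n := HL2 _ (Hh n).
  have [|g g2 gP] := L2_complete h2.
    by move=> n; rewrite ipR_norm ?lee_fin; [exact: hc|exact: L2_sub].
  exists g.
    apply: (Hclosed h) => //.
    have c0 : (2 * (2 ^+ n)^-1)%:E @[n --> \oo] --> (0 : R)%:E.
      by apply: cvg_EFin; [exact: nearW|exact: cvg_mul_exp2V].
    apply: (squeeze_cvge _ (cvg_cst 0%E) c0); apply: nearW => n.
    by rewrite gP andbT; apply: integral_ge0 => x _; rewrite lee_fin sqr_ge0.
  by move=> n; have := gP n; rewrite ipR_norm ?lee_fin//; exact: L2_sub.
(* Since [H] is a complex subspace, real orthogonality also holds against ['i * w], and this kills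
   the imaginary part. *)
exists g; split => // w Hw; apply: eq_ReIm; first by rewrite ipRE; exact: gP.
rewrite ipIE; apply: gP.
have := Hlin 'i%C _ _ Hw H0; congr H.
by apply/funext => x; rewrite addr0.
Qed.
End L2_projection.

(** * Weak-* limits *)

(** The image of [U] is refined to an ultrafilter [G], which converges by compactness of the
    segment. As [U] decides the preimage of every neighbourhood of that limit, the image of [U]
    already converges to it. *)
Lemma ultra_bounded_cvg {R : realType} {I : Type} (U : set_system I) (a : I -> R) (M : R) :
  UltraFilter U -> (forall i, `|a i| <= M) -> cvg (a @ U).
Proof.
move=> UU aM; have PU := @ultra_proper _ _ UU.
have [G [UG aG]] := ultraFilterLemma (fmap_proper_filter a PU).
have PG := @ultra_proper _ _ UG.
have GM : G `[-M, M]%classic.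
  by apply/aG/nearW => i; rewrite /= in_itv/= -ler_norml.
have := @segment_compact R (-M) M; rewrite compact_ultra => /(_ G UG GM)[p [_ Gp]].
apply/cvg_ex; exists p => N Np.
have [//|UN] := in_ultra_setVsetC (a @^-1` N) UU.
have GN : G (~` N) by exact: aG.
by have /filter_ex[x []] : G (N `&` ~` N) by apply: filterI => //; exact: Gp.
Qed.

Section weak_limit.
Context {R : realType} {X : ptopologicalType}.
Hypotheses (HX : hausdorff_space X) (KX : compact [set: X]).
Local Notation T := (BorelT X).
Variables (mu : {measure set T -> \bar R}) (U : set_system nat).
Hypothesis UU : UltraFilter U.
Let PU : ProperFilter U := @ultra_proper _ _ UU.
Local Existing Instance PU.

Lemma continuous_mul_integrable (f p : X -> R) : continuous f ->
  mu.-integrable [set: T] (EFin \o p) ->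
  mu.-integrable [set: T] (EFin \o (fun x => f x * p x)).
Proof.
move=> cf pi; have [M M0 fM] := compact_continuous_bounded KX cf.
have mf := continuous_borel_measurable cf.
have /integrableP[/measurable_EFinP mp _] := pi.
have /(integrable_EFinZ M) ni := integrable_norm pi.
apply: integrable_dominated ni; first exact: measurable_funM.
by move=> x /=; rewrite normrM ler_wpM2r.
Qed.

Lemma continuous_mul_Rintegral_le (f p : X -> R) (M K : R) : continuous f ->
  (forall x, `|f x| <= M) -> mu.-integrable [set: T] (EFin \o p) ->
  \int[mu]_x `|p x| <= K -> `|\int[mu]_x (f x * p x)| <= M * K.
Proof.
move=> cf fM pi pK; have fpi := continuous_mul_integrable cf pi.
apply: le_trans (le_normr_Rintegral _ fpi) _ => //.
have M0 : 0 <= M by apply: le_trans (fM point).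
have npi := integrable_norm pi.
apply: (@le_trans _ _ (\int[mu]_x (M * `|p x|))).
  apply: le_Rintegral => //; [exact: integrable_norm|exact: integrable_EFinZ|].
  by move=> x _; rewrite normrM ler_wpM2r.
by rewrite RintegralZl// ler_wpM2l.
Qed.

(** The limit along [U] exists for every continuous [f] at once and inherits linearity and
    positivity, so [riesz_markov] represents it. *)
Lemma weak_limit_ge0 (p : nat -> X -> R) (K : R) :
  (forall n, mu.-integrable [set: T] (EFin \o p n)) ->
  (forall n x, 0 <= p n x) -> (forall n, \int[mu]_x (p n x) <= K) ->
  exists m : {measure set T -> \bar R}, finite_regular m /\
    forall f : X -> R, continuous f ->
      \int[mu]_x (f x * p n x) @[n --> U] --> \int[m]_x (f x).
Proof.
move=> pi p0 pK.
pose L (f : X -> R) := lim (\int[mu]_x (f x * p n x) @[n --> U]).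
have cL (f : X -> R) : continuous f -> \int[mu]_x (f x * p n x) @[n --> U] --> L f.
  move=> cf; have [M M0 fM] := compact_continuous_bounded KX cf.
  apply: (@ultra_bounded_cvg _ _ _ _ (M * K)) => // n.
  apply: continuous_mul_Rintegral_le => //.
  by rewrite (_ : Rintegral _ _ _ = \int[mu]_x (p n x))//; apply: eq_Rintegral => x _; rewrite ger0_norm.
have [|f cf f0|m [rm Lm]] := @riesz_markov R X HX KX L.
- move=> a f g cf cg; apply: cvg_lim => //.
  have -> : (fun n => \int[mu]_x ((a * f x + g x) * p n x)) =
      (fun n => a * \int[mu]_x (f x * p n x) + \int[mu]_x (g x * p n x)).
    apply/funext => n; have fi := continuous_mul_integrable cf (pi n).
    have gi := continuous_mul_integrable cg (pi n).
    rewrite -RintegralZl// -RintegralD//; last exact: integrable_EFinZ.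
    by apply: eq_Rintegral => x _; ring.
  by apply: cvgD; [apply: cvgMr; exact: cL|exact: cL].
- apply: limr_ge; first by apply/cvg_ex; exists (L f); exact: cL.
  by apply: nearW => n; apply: Rintegral_ge0 => x _; rewrite mulr_ge0.
- by exists m; split => // f cf; rewrite -Lm//; exact: cL.
Qed.

(** Positive and negative parts are passed to the limit separately. The resulting [m1] and [m2] need
    not be mutually singular, which the encoding of complex measures permits. *)
Lemma weak_limit (p : nat -> X -> R) (K : R) :
  (forall n, mu.-integrable [set: T] (EFin \o p n)) ->
  (forall n, \int[mu]_x `|p n x| <= K) ->
  exists m1 m2 : {measure set T -> \bar R},
    [/\ finite_regular m1, finite_regular m2 & forall f : X -> R, continuous f ->
      \int[mu]_x (f x * p n x) @[n --> U] --> \int[m1]_x (f x) - \int[m2]_x (f x)].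
Proof.
move=> pi pK.
have mp n : measurable_fun [set: T] (p n).
  by have /integrableP[/measurable_EFinP] := pi n.
have npi n := integrable_norm (pi n).
pose pp n x := Num.max (p n x) 0; pose pm n x := Num.max (- p n x) 0.
have ppi n : mu.-integrable [set: T] (EFin \o pp n).
  apply: integrable_dominated (npi n).
    by apply: measurable_maxr.
  by move=> x; rewrite /pp /=; case: (leP (p n x) 0); rewrite ?normr0.
have pmi n : mu.-integrable [set: T] (EFin \o pm n).
  apply: integrable_dominated (npi n).
    by apply: measurable_maxr => //; exact: measurable_funN.
  by move=> x; rewrite /pm /=; case: (leP (- p n x) 0); rewrite ?normr0 ?normrN.
have [||n|m1 [r1 c1]] := @weak_limit_ge0 pp K.
- exact: ppi.
- by move=> n x; rewrite /pp le_max lexx orbT.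
- apply: le_trans (pK n); apply: le_Rintegral; [by []|exact: ppi|exact: npi|].
  by move=> x _; rewrite ge_max ler_norm normr_ge0.
have [||n|m2 [r2 c2]] := @weak_limit_ge0 pm K.
- exact: pmi.
- by move=> n x; rewrite /pm le_max lexx orbT.
- apply: le_trans (pK n); apply: le_Rintegral; [by []|exact: pmi|exact: npi|].
  by move=> x _; rewrite ge_max -normrN ler_norm normr_ge0.
exists m1, m2; split => // f cf.
have -> : (fun n => \int[mu]_x (f x * p n x)) =
    (fun n => \int[mu]_x (f x * pp n x) - \int[mu]_x (f x * pm n x)).
  apply/funext => n; rewrite -RintegralB//; try exact: continuous_mul_integrable.
  apply: eq_Rintegral => x _; rewrite -mulrBr /pp /pm; congr (_ * _).
  by case: (leP (p n x) 0) => h; case: (leP (- p n x) 0) => h'; lra.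
by apply: cvgB; [exact: c1|exact: c2].
Qed.

End weak_limit.

Section complex_weak_limit.
Context {R : realType} {X : ptopologicalType}.
Hypotheses (HX : hausdorff_space X) (KX : compact [set: X]).
Local Notation T := (BorelT X).

Lemma normr_Re_le (a : R[i]) : `|complex.Re a| <= cabs a.
Proof. by rewrite -sqrtr_sqr ler_sqrt ?addr_ge0 ?sqr_ge0// lerDl sqr_ge0. Qed.

Lemma normr_Im_le (a : R[i]) : `|complex.Im a| <= cabs a.
Proof. by rewrite -sqrtr_sqr ler_sqrt ?addr_ge0 ?sqr_ge0// lerDr sqr_ge0. Qed.

Lemma cabs_le (a : R[i]) : cabs a <= `|complex.Re a| + `|complex.Im a|.
Proof.
rewrite -ler_sqr ?nnegrE ?addr_ge0 ?cabs_ge0// cabs_sqr sqrrD !real_normK ?num_real//.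
by rewrite lerD2r lerDl mulrn_wge0// mulr_ge0.
Qed.

Lemma cmeasurable_cabs (f : X -> R[i]) : cmeasurable f ->
  measurable_fun [set: T] (fun x : T => cabs (f x)).
Proof.
move=> [mr mi]; apply: (measurableT_comp (continuous_measurable_fun (@sqrt_continuous R))).
by apply: measurable_funD; exact: measurable_funX.
Qed.

Variable mu : {measure set T -> \bar R}.

Lemma L1norm_integrable (f : X -> R[i]) : cmeasurable f -> (L1norm mu f < +oo)%E ->
  [/\ mu.-integrable [set: T] (EFin \o (fun x => cabs (f x))),
      mu.-integrable [set: T] (EFin \o (fun x => complex.Re (f x))) &
      mu.-integrable [set: T] (EFin \o (fun x => complex.Im (f x)))].
Proof.
move=> mf fi; have mc := cmeasurable_cabs mf.
have ci : mu.-integrable [set: T] (EFin \o (fun x => cabs (f x))).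
  by apply/ge0_integrableP => // x; exact: cabs_ge0.
split => //; apply: integrable_dominated ci => //; try by case: mf.
  by move=> x; exact: normr_Re_le.
by move=> x; exact: normr_Im_le.
Qed.

Section pairing.
Variables m1 m2 m3 m4 : {measure set T -> \bar R}.

Lemma Re_cmeas_int (f : X -> R[i]) : complex.Re (cmeas_int m1 m2 m3 m4 f) =
  (\int[m1]_x complex.Re (f x) - \int[m2]_x complex.Re (f x)) -
  (\int[m3]_x complex.Im (f x) - \int[m4]_x complex.Im (f x)).
Proof. by rewrite /cmeas_int !ReIm /=; ring. Qed.

Lemma Im_cmeas_int (f : X -> R[i]) : complex.Im (cmeas_int m1 m2 m3 m4 f) =
  (\int[m1]_x complex.Im (f x) - \int[m2]_x complex.Im (f x)) +
  (\int[m3]_x complex.Re (f x) - \int[m4]_x complex.Re (f x)).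
Proof. by rewrite /cmeas_int !ReIm /=; ring. Qed.

End pairing.

Variable U : set_system nat.
Hypothesis UU : UltraFilter U.
Let PU : ProperFilter U := @ultra_proper _ _ UU.
Local Existing Instance PU.

(** [m1] and [m2] come from the real parts of [h n], [m3] and [m4] from the imaginary parts; the
    same ultrafilter serves both, so there are no subsequences to reconcile. *)
Lemma complex_weak_limit (h : nat -> X -> R[i]) (K : R) :
  (forall n, cmeasurable (h n)) -> (forall n, (L1norm mu (h n) <= K%:E)%E) ->
  exists m1 m2 m3 m4 : {measure set T -> \bar R},
    [/\ finite_regular m1, finite_regular m2, finite_regular m3, finite_regular m4 &
      forall f : X -> R[i], ccontinuous f ->
        complex.Re (cint mu (fun x => f x * h n x)) @[n --> U] -->
          complex.Re (cmeas_int m1 m2 m3 m4 f) /\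
        complex.Im (cint mu (fun x => f x * h n x)) @[n --> U] -->
          complex.Im (cmeas_int m1 m2 m3 m4 f)].
Proof.
move=> mh hK.
have hi n : (L1norm mu (h n) < +oo)%E by rewrite (le_lt_trans (hK n))// ltry.
have ci n : mu.-integrable [set: T] (EFin \o (fun x => cabs (h n x))).
  by case: (L1norm_integrable (mh n) (hi n)).
have ri n : mu.-integrable [set: T] (EFin \o (fun x => complex.Re (h n x))).
  by case: (L1norm_integrable (mh n) (hi n)).
have ii n : mu.-integrable [set: T] (EFin \o (fun x => complex.Im (h n x))).
  by case: (L1norm_integrable (mh n) (hi n)).
have cK n : \int[mu]_x cabs (h n x) <= K.
  rewrite -lee_fin /Rintegral fineK; first exact: hK.
  exact: integrable_fin_num (ci n).
have [|m1 [m2 [r1 r2 c12]]] := weak_limit HX KX UU ri (K := K).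
  move=> n; apply: le_trans (cK n); apply: le_Rintegral => //.
    exact: integrable_norm.
  by move=> x _; exact: normr_Re_le.
have [|m3 [m4 [r3 r4 c34]]] := weak_limit HX KX UU ii (K := K).
  move=> n; apply: le_trans (cK n); apply: le_Rintegral => //.
    exact: integrable_norm.
  by move=> x _; exact: normr_Im_le.
exists m1, m2, m3, m4; split => // f [fr fi].
have rr n := continuous_mul_integrable KX fr (ri n).
have ir n := continuous_mul_integrable KX fi (ri n).
have ri' n := continuous_mul_integrable KX fr (ii n).
have ii' n := continuous_mul_integrable KX fi (ii n).
rewrite Re_cmeas_int Im_cmeas_int; split.
  have -> : (fun n => complex.Re (cint mu (fun x => f x * h n x))) =
      (fun n => \int[mu]_x (complex.Re (f x) * complex.Re (h n x)) -
                \int[mu]_x (complex.Im (f x) * complex.Im (h n x))).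
    apply/funext => n; rewrite -RintegralB//.
    by apply: eq_Rintegral => x _; rewrite ReME.
  by apply: cvgB; [exact: c12|exact: c34].
have -> : (fun n => complex.Im (cint mu (fun x => f x * h n x))) =
    (fun n => \int[mu]_x (complex.Im (f x) * complex.Re (h n x)) +
              \int[mu]_x (complex.Re (f x) * complex.Im (h n x))).
  apply/funext => n; rewrite -RintegralD//.
  by apply: eq_Rintegral => x _; rewrite ImME addrC.
by apply: cvgD; [exact: c12|exact: c34].
Qed.

(** A basic neighbourhood involves finitely many test functions, so a single index taken from a set
    in [U] meets all its conditions. *)
Lemma in_weakstar_closure_cvg (H : set (X -> R[i])) (h : nat -> X -> R[i])
    (m1 m2 m3 m4 : {measure set T -> \bar R}) :
  (forall n, H (h n)) ->
  (forall f : X -> R[i], ccontinuous f ->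
     complex.Re (cint mu (fun x => f x * h n x)) @[n --> U] -->
       complex.Re (cmeas_int m1 m2 m3 m4 f) /\
     complex.Im (cint mu (fun x => f x * h n x)) @[n --> U] -->
       complex.Im (cmeas_int m1 m2 m3 m4 f)) ->
  in_weakstar_closure mu H m1 m2 m3 m4.
Proof.
move=> Hh hc n phi cphi e e0.
have e2 : 0 < e / 2 by rewrite divr_gt0.
suff /filter_ex[k kP] : \forall k \near U, forall i : 'I_n,
    cabs (cint mu (fun x => phi i x * h k x) - cmeas_int m1 m2 m3 m4 (phi i)) < e.
  by exists (h k).
apply: filter_forall => i; have [/cvgrPdist_lt cr /cvgrPdist_lt cim] := hc _ (cphi i).
near=> k; apply: le_lt_trans (cabs_le _) _.
rewrite !ReIm [e]splitr ltrD//; rewrite distrC; near: k.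
  exact: cr.
exact: cim.
Unshelve. all: by end_near. Qed.

End complex_weak_limit.

(** * Peak functions, densities near the peak point, and the contradiction *)

Section peak.
Context {R : realType} {X : ptopologicalType}.
Local Notation T := (BorelT X).

Lemma cabsM (a b : R[i]) : cabs (a * b) = cabs a * cabs b.
Proof.
rewrite /cabs -sqrtrM ?addr_ge0 ?sqr_ge0//; congr Num.sqrt.
by rewrite ReME ImME; ring.
Qed.

Lemma cabsX (a : R[i]) n : cabs (a ^+ n) = cabs a ^+ n.
Proof.
elim: n => [|n IH]; last by rewrite !exprS cabsM IH.
by rewrite !expr0 /cabs /= expr1n expr0n /= addr0 sqrtr1.
Qed.

(** The pointwise limit is [c] times the indicator of [x0], with the constant 1 as dominating
    function. It serves the real parts with [c = 1] and the imaginary parts with [c = 0]. *)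
Lemma peak_dominated_cvg (m : {measure set T -> \bar R}) (u : nat -> X -> R)
    (x0 : X) (c : R) :
  closed [set x0] -> (m setT < +oo)%E ->
  (forall n, measurable_fun [set: T] (u n)) ->
  (forall n x, `|u n x| <= 1) -> (forall n, u n x0 = c) ->
  (forall x, x <> x0 -> u n x @[n --> \oo] --> (0 : R)) ->
  \int[m]_x u n x @[n --> \oo] --> c * fine (m [set x0]).
Proof.
move=> cx0 fm mu u1 ux0 uc.
have mx0 : measurable ([set x0] : set T).
  rewrite -[X in measurable X]setCK; apply: measurableC; apply: open_borel_measurable.
  exact: closed_openC.
have mi : measurable_fun [set: T] (fun x => c * \1_[set x0] x : R).
  by apply: measurable_funM => //; exact: measurable_indic.
have := @dominated_cvg _ T R m setT measurableT (fun n x => (u n x)%:E)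
  (fun x => (c * \1_[set x0] x)%:E) (cst 1%:E).
have -> : (\int[m]_x (c * \1_[set x0] x)%:E = (c * fine (m [set x0]))%:E)%E.
  under eq_integral do rewrite EFinM.
  rewrite integralZl//.
    rewrite integral_indic// setIT EFinM fineK// ge0_fin_numE//.
    by apply: le_lt_trans fm; apply: le_measure; rewrite ?inE.
  apply: (@bounded_integrable _ T R m (\1_[set x0] : T -> R) 1) => //.
  by move=> x; rewrite indicE ger0_norm// lern1 leq_b1.
move=> h; apply: (@fine_cvg _ _ _ _ (fun n => \int[m]_x (u n x)%:E)%E); apply: h.
- by move=> n; exact/measurable_EFinP.
- move=> x _; apply: cvg_EFin; first exact: nearW.
  have [xx|xx] := pselect (x = x0).
    rewrite xx indicE mem_set// mulr1; apply: cvg_near_cst; apply: nearW => n /=.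
    exact: ux0.
  by rewrite indicE memNset// mulr0; exact: uc.
- by [].
- apply: (@bounded_integrable _ T R m (cst 1) 1) => //.
  by move=> x; rewrite normr1.
- by move=> n x _; rewrite lee_fin.
Qed.

End peak.

Lemma Rintegral_weighted_near d (T : measurableType d) (R : realType)
    (m : {measure set T -> \bar R}) (a v : T -> R) (b e : R) :
  (forall x, 0 <= a x) -> m.-integrable setT (EFin \o a) ->
  m.-integrable setT (EFin \o (fun x => a x * v x)) -> \int[m]_x a x = 1 ->
  (forall x, a x != 0 -> `|v x - b| <= e) -> `|\int[m]_x (a x * v x) - b| <= e.
Proof.
move=> a0 ai avi a1 ve.
have bai := integrable_EFinZ b ai.
rewrite -[b]mulr1 -a1 -RintegralZl// -RintegralB//.
have di := integrable_EFinB avi bai.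
apply: le_trans (le_normr_Rintegral _ di) _ => //.
rewrite -[leRHS]mulr1 -a1 -RintegralZl//.
apply: le_Rintegral => //; [exact: integrable_norm|exact: integrable_EFinZ|].
move=> x _; rewrite [b * _]mulrC -mulrBr normrM (ger0_norm (a0 x)) [leRHS]mulrC.
have [->|ax] := eqVneq (a x) 0; first by rewrite !mul0r.
by rewrite ler_wpM2l// ve.
Qed.

Lemma ipB (R : realType) (X : ptopologicalType) (mu : {measure set (BorelT X) -> \bar R})
    (f g w : X -> R[i]) : L2 mu f -> L2 mu g -> L2 mu w ->
  ip mu (fun x => f x - g x) w = ip mu f w - ip mu g w.
Proof.
move=> f2 g2 w2.
have [f1 f3 f4 f5] := L2_integrable f2 w2; have [g1 g3 g4 g5] := L2_integrable g2 w2.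
apply: eq_ReIm; rewrite !ReIm /= -RintegralB//.
- by apply: eq_Rintegral => x _; rewrite !ReIm; ring.
- by under eq_fun do rewrite !ReIm mulrN opprK; exact: integrable_EFinD.
- by under eq_fun do rewrite !ReIm mulrN opprK; exact: integrable_EFinD.
- by apply: eq_Rintegral => x _; rewrite !ReIm; ring.
- by under eq_fun do rewrite !ReIm mulrN addrC; exact: integrable_EFinB.
- by under eq_fun do rewrite !ReIm mulrN addrC; exact: integrable_EFinB.
Qed.

Lemma open_norm_sub_lt (R : realType) (X : topologicalType) (g : X -> R) (b e : R) :
  continuous g -> open [set x | `|g x - b| < e].
Proof.
move=> cg; apply: (@open_comp _ _ (fun x => `|g x - b|) [set y | y < e]); last exact: open_lt.
by move=> x _; apply: cvg_norm; apply: cvgB; [exact: cg|exact: cvg_cst].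
Qed.

(* The [f n] are normalised indicators of neighbourhoods of [x0] cut out by
   [w 0], ..., [w n], so that the means of each [w k] converge by construction. *)
Lemma approximate_identity (R : realType) (X : ptopologicalType)
    (mu : {measure set (BorelT X) -> \bar R}) (w : nat -> X -> R[i]) (x0 : X) :
  finite_measure mu -> full_support mu -> (forall k, ccontinuous (w k)) ->
  (forall k, L2 mu (w k)) -> (forall k, w k x0 = 1) ->
  exists f : nat -> X -> R[i], [/\ forall n, L2 mu (f n),
    forall n, L1norm mu (f n) = 1%E &
    forall k, complex.Re (ip mu (f n) (w k)) @[n --> \oo] --> (1 : R)].
Proof.
move=> fmu fs cw w2 w1.
pose e n : R := n.+1%:R^-1.
have e0 n : 0 < e n by rewrite invr_gt0.
pose V n k := [set x | `|complex.Re (w k x) - 1| < e n].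
pose U n := \bigcap_(k < n.+1) V n k.
have oU n : open (U n).
  rewrite /U bigcap_mkord; apply: big_ind; [exact: openT|exact: openI|].
  by move=> k _; apply: open_norm_sub_lt; case: (cw k).
have mU n : measurable (U n : set (BorelT X)) by exact: open_borel_measurable.
have Ux0 n : U n x0 by move=> k _; rewrite /V /= w1 subrr normr0.
have fU n : mu (U n) \is a fin_num.
  by rewrite ge0_fin_numE//; apply: le_lt_trans fmu; apply: le_measure; rewrite ?inE.
(* [U n] is open and contains [x0], so full support makes the normalisation legitimate. *)
have U0 n : 0 < fine (mu (U n)).
  apply: fine_gt0; rewrite -ge0_fin_numE// fU andbT.
  by apply: fs; [exact: oU|exists x0; exact: Ux0].
pose a n (x : X) : R := (fine (mu (U n)))^-1 * \1_(U n) x.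
have a0 n x : 0 <= a n x by apply: mulr_ge0; [rewrite invr_ge0 ltW|rewrite indicE].
have mi n : measurable_fun [set: BorelT X] (\1_(U n) : BorelT X -> R).
  exact: measurable_indic.
have ma n : measurable_fun [set: BorelT X] (a n : BorelT X -> R).
  exact: measurable_funM.
have a_le n x : `|a n x| <= (fine (mu (U n)))^-1.
  rewrite ger0_norm// /a indicE; case: (_ \in _); rewrite ?mulr1// mulr0.
  by rewrite invr_ge0 ltW.
have ai n : mu.-integrable [set: BorelT X] (EFin \o (a n : BorelT X -> R)).
  exact: (@bounded_integrable _ (BorelT X) _ mu _ _ fmu (ma n) (a_le n)).
have a1 n : \int[mu]_x a n x = 1.
  rewrite RintegralZl//.
    rewrite /Rintegral integral_indic//.
    by rewrite setIT mulVf// gt_eqF.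
  apply: (@bounded_integrable _ (BorelT X) _ mu (\1_(U n) : BorelT X -> R) 1) => //.
  by move=> x; rewrite indicE ger0_norm// lern1 leq_b1.
pose f n x := (a n x)%:C%C.
have f2 n : L2 mu (f n).
  apply/L2P; split.
  - exact: ma.
  - exact: measurable_cst.
  - apply: (@bounded_integrable _ (BorelT X) _ mu (fun x => a n x ^+ 2)
      ((fine (mu (U n)))^-1 ^+ 2) fmu); first exact: measurable_funX.
    by move=> x; rewrite normrX /= lerXn2r// nnegrE// invr_ge0 ltW.
  - rewrite (_ : EFin \o _ = cst 0%E); first exact: integrable0.
    by apply/funext => x /=; rewrite expr0n.
exists f; split => //.
- move=> n; rewrite /L1norm -(a1 n) /Rintegral fineK.
    apply: eq_integral => x _; congr (_%:E).
    by rewrite /cabs /= expr0n addr0 sqrtr_sqr ger0_norm.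
  exact: integrable_fin_num (ai n).
- move=> k.
  have -> : (fun n => complex.Re (ip mu (f n) (w k))) =
      (fun n => \int[mu]_x (a n x * complex.Re (w k x))).
    apply/funext => n; apply: eq_Rintegral => x _.
    by rewrite !ReIm /= mul0r subr0.
  apply/cvgrPdist_lt => c c0.
  have [N hN] : exists N, e N < c.
    exists (Num.bound c^-1); rewrite /e invf_plt ?posrE//.
    apply: lt_le_trans (archi_boundP _) _; first by rewrite invr_ge0 ltW.
    by rewrite ler_nat.
  (* [k <= n] puts the condition on [w k] among those defining [U n]; [N <= n] brings its tolerance
     [e n] below [c]. *)
  exists (maxn N k) => // n /=; rewrite geq_max => /andP[Nn kn].
  rewrite distrC; apply: le_lt_trans hN.
  apply: (@le_trans _ _ (e n)); last by rewrite /e lef_pV2 ?posrE// ler_nat ltnS.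
  apply: Rintegral_weighted_near => //.
    by have [] := L2_integrable (f2 n) (w2 k).
  move=> x; rewrite /a indicE; have [|_] := boolP (x \in U n); last by rewrite mulr0 eqxx.
  by rewrite inE => /(_ k) Ux _; apply/ltW/Ux; rewrite /= ltnS.
Qed.

Theorem theorem3p7 (R : realType) (X : ptopologicalType)
  (mu : {measure set (BorelT X) -> \bar R})
  (H A : set (X -> R[i])) (x0 : X) :
  hausdorff_space X -> compact [set: X] -> connected [set: X] ->
  finite_regular mu -> full_support mu ->
  closed_L2_subspace mu H ->
  function_algebra_in H A ->
  peak_point A x0 ->
  (forall m1 m2 m3 m4 : {measure set (BorelT X) -> \bar R},
     finite_regular m1 -> finite_regular m2 ->
     finite_regular m3 -> finite_regular m4 ->
     in_weakstar_closure mu H m1 m2 m3 m4 ->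
     cmeas_val m1 m2 m3 m4 [set x0] = 0) ->
  ~ proj_L1_bounded mu H.
Proof.
move=> HX KX _ [fmu _] fs Hcl [AH [_ [_ Amul]]] [f0 [Af0 [f01 f0lt]]] M0 [K HK].
pose w k x := f0 x ^+ k.+1.
have Aw k : A (w k).
  elim: k => [|k IH]; first by rewrite (_ : w 0%N = f0)//; apply/funext => x; rewrite /w expr1.
  by have := Amul _ _ Af0 IH; congr A; apply/funext => x; rewrite /w -exprS.
have cw k : ccontinuous (w k) by case: (AH _ (Aw k)).
have Hw k : H (w k) by case: (AH _ (Aw k)).
have HL2 : forall h, H h -> L2 mu h by case: Hcl.
have w1 k : w k x0 = 1 by rewrite /w f01 expr1n.
have [f [f2 fn fw]] := approximate_identity fmu fs cw (fun k => HL2 _ (Hw k)) w1.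
have /choice[h hP] n : exists g, is_orth_proj mu H (f n) g.
  exact: orth_proj_exists.
have Hh n : H (h n) by case: (hP n).
have hK n : (L1norm mu (h n) <= K%:E)%E.
  by have := HK _ _ (f2 n) (hP n); rewrite fn mule1.
have mh n : cmeasurable (h n) by case: (HL2 _ (Hh n)).
(* Being finer than [\oo], [U] preserves the limits supplied by [approximate_identity]. *)
have [U [UU ooU]] := @ultraFilterLemma nat \oo _.
have PU := @ultra_proper _ _ UU.
have [m1 [m2 [m3 [m4 [r1 r2 r3 r4 hm]]]]] := complex_weak_limit HX KX UU mh hK.
have val0 := M0 _ _ _ _ r1 r2 r3 r4 (in_weakstar_closure_cvg UU Hh hm).
(* The pairing with measures is bilinear whereas [ip] conjugates its second argument, so the test
   functions are the conjugates; they are continuous but need not lie in [H]. *)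
pose v k x := conjc (w k x).
have cv k : ccontinuous (v k).
  have [cr ci] := cw k; split.
    by rewrite (_ : (fun x => _) = (fun x => complex.Re (w k x)))//; apply/funext => x; rewrite ReJE.
  rewrite (_ : (fun x => _) = (fun x => - complex.Im (w k x))).
    by move=> x; apply: cvgN; exact: ci.
  by apply/funext => x; rewrite ImJE.
have hv k : complex.Re (cmeas_int m1 m2 m3 m4 (v k)) = 1.
  have [hr _] := hm _ (cv k).
  apply: (cvg_unique _ hr) => //.
  have -> : (fun n => complex.Re (cint mu (fun x => v k x * h n x))) =
      (fun n => complex.Re (ip mu (f n) (w k))).
    apply/funext => n; congr complex.Re.
    have [_ /(_ _ (Hw k))] := hP n.
    rewrite ipB//; [|exact: HL2|exact: HL2] => /eqP; rewrite subr_eq0 => /eqP ->.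
    by rewrite /ip; congr cint; apply/funext => x; rewrite mulrC.
  by apply: cvg_trans (fw k); exact: cvg_app.
have cx0 : closed [set x0] by apply: accessible_closed_set1; exact: hausdorff_accessible.
have f0le x : cabs (f0 x) <= 1.
  have [->|/f0lt/ltW//] := pselect (x = x0).
  by rewrite f01 /cabs /= expr1n expr0n addr0 sqrtr1.
have cabs_v k x : cabs (v k x) = cabs (f0 x) ^+ k.+1.
  by rewrite -cabsX /cabs ReJE ImJE sqrrN.
have v1 k x : cabs (v k x) <= 1 by rewrite cabs_v exprn_ile1// cabs_ge0.
have v0 (u : nat -> R) x : x <> x0 -> (forall k, `|u k| <= cabs (v k x)) ->
    u n @[n --> \oo] --> (0 : R).
  move=> /f0lt z1 uv.
  have z : cabs (f0 x) ^+ n.+1 @[n --> \oo] --> (0 : R).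
    rewrite (_ : (fun n => _) = geometric (cabs (f0 x)) (cabs (f0 x))).
      by apply: cvg_geometric; rewrite ger0_norm ?cabs_ge0.
    by apply/funext => n; rewrite /= exprS.
  apply/norm_cvg0P; apply: (squeeze_cvgr _ (cvg_cst 0) z).
  by apply: nearW => n; rewrite normr_ge0 -cabs_v uv.
have cvgRe (m : {measure set (BorelT X) -> \bar R}) : finite_regular m ->
    \int[m]_x complex.Re (v n x) @[n --> \oo] --> fine (m [set x0]).
  move=> [fm _]; rewrite -[fine _]mul1r.
  apply: (@peak_dominated_cvg R X m (fun k x => complex.Re (v k x)) x0 1) => //.
  - by move=> k; apply: continuous_borel_measurable; case: (cv k).
  - by move=> k x; apply: le_trans (normr_Re_le _) (v1 k x).
  - by move=> k; rewrite ReJE w1.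
  - by move=> x xx0; apply: (v0 _ x) => // k; exact: normr_Re_le.
have cvgIm (m : {measure set (BorelT X) -> \bar R}) : finite_regular m ->
    \int[m]_x complex.Im (v n x) @[n --> \oo] --> (0 : R).
  move=> [fm _]; rewrite -[0 : R](mul0r (fine (m [set x0]))).
  apply: (@peak_dominated_cvg R X m (fun k x => complex.Im (v k x)) x0 0) => //.
  - by move=> k; apply: continuous_borel_measurable; case: (cv k).
  - by move=> k x; apply: le_trans (normr_Im_le _) (v1 k x).
  - by move=> k; rewrite ImJE w1 oppr0.
  - by move=> x xx0; apply: (v0 _ x) => // k; exact: normr_Im_le.
(* Real parts suffice: as [v k x0 = 1] is real, the integrals of the imaginary parts against [m3]
   and [m4] tend to 0, and what remains is the real part of the mass at [x0]. *)
have lim : (1 : R) @[n --> \oo] --> (fine (m1 [set x0]) - fine (m2 [set x0])) - (0 - 0).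
  rewrite (_ : (fun _ : nat => 1) = (fun k => complex.Re (cmeas_int m1 m2 m3 m4 (v k)))).
    under eq_fun do rewrite Re_cmeas_int.
    by apply: cvgB; apply: cvgB; [exact: cvgRe|exact: cvgRe|exact: cvgIm|exact: cvgIm].
  by apply/funext => k; rewrite hv.
have e12 : fine (m1 [set x0]) - fine (m2 [set x0]) = 0.
  exact: (congr1 (@complex.Re R) val0).
have := cvg_unique (@Rhausdorff R) (cvg_cst (1 : R)) lim.
by rewrite e12 !subr0 => e10; have := oner_neq0 R; rewrite e10 eqxx.
Qed.
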